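(* For every entire function $f$ on $\mathbb{C}$, the vector-valued holomorphic function $\Phi=\Phi_f$ on $\mathbb{C}^k$ satisfies the differential system $$(-1)^{k+h}\frac{\partial\Phi}{\partial s_h}(s)=\frac{\partial (A(s)^{k-h}\Phi)}{\partial s_k}(s)\qquad\forall s\in\mathbb{C}^k,\ \forall h\in[1,k-1].\qquad(@)$$ Moreover, this system is integrable, in the sense that for any holomorphic solution $\Phi$ of $(@)$ and any $h,j\in[1,k-1]$, computing $\frac{\partial^2\Phi}{\partial s_j\partial s_h}$ by applying $(@)$ twice gives $$(-1)^{h+j}\frac{\partial^2\Phi}{\partial s_j\partial s_h}=\frac{\partial^2}{\partial s_k^2}\big(A(s)^{2k-h-j}\Phi\big),$$ which is symmetric in $(h,j)$; and if $\Phi$ is a holomorphic solution of $(@)$, then so is $A(s)\Phi$.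
   Context: Fix an integer $k\ge 2$. Use coordinates $s=(s_1,\dots,s_k)$ on $\mathbb{C}^k$, set $s_0:=1$ and $P_s(z):=\sum_{h=0}^k(-1)^hs_hz^{k-h}$. Let $E(z):=(1,z,\dots,z^{k-1})^T$. For an entire function $f$, define $\Phi_f(s):=\frac{1}{2i\pi}\int_{|\zeta|=R}\frac{f(\zeta)E(\zeta)\,d\zeta}{P_s(\zeta)}$, with $R$ large enough that all roots of $P_s$ lie in $\{|\zeta|<R\}$ (independent of such $R$; holomorphic in $s$). $A(s)$ is the $(k,k)$ companion matrix of $P_s$: its entries are $A_{i,i+1}=1$ for $i\in[1,k-1]$, its last row is $A_{k,j}=(-1)^{k-j}s_{k+1-j}$ for $j\in[1,k]$ (i.e. $((-1)^{k-1}s_k,\dots,(-1)^{h-1}s_h,\dots,s_1)$), and all other entries are $0$. *)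

(* Defs.v *)
From HB Require Import structures.
From mathcomp Require Import all_boot all_order all_algebra.
From mathcomp Require Import all_classical all_reals all_analysis.
From mathcomp Require Import complex.
Set Implicit Arguments. Unset Strict Implicit. Unset Printing Implicit Defensive.
Import Order.TTheory GRing.Theory Num.Theory.
Import numFieldNormedType.Exports.
Local Open Scope ring_scope.
Local Open Scope complex_scope.

(* The complex field C = R[i], seen as a numFieldType (hence a normed field,
   so that 'D_v / differentiable mean complex (C-linear) differentiability). *)
Definition CC (R : realType) : numFieldType := (R[i] : numFieldType).

Definition cmod (R : realType) (z : CC R) : R :=
  Num.sqrt (complex.Re z ^+ 2 + complex.Im z ^+ 2).

(* s_h for s = (s_1,...,s_k) stored as s 0 (h-1); s_0 := 1; 0 beyond k *)
Definition scoef (R : realType) (k : nat) (s : 'rV[CC R]_k) (h : nat) : CC R :=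
  if h is h'.+1 then
    (match @insub _ _ 'I_k h' with Some i => s 0 i | None => 0 end)
  else 1.

Definition Ps (R : realType) (k : nat) (s : 'rV[CC R]_k) (z : CC R) : CC R :=
  \sum_(h < k.+1) (-1) ^+ h * scoef s h * z ^+ (k - h).

Definition Evec (R : realType) (k : nat) (z : CC R) : 'cV[CC R]_k :=
  \col_(i < k) z ^+ i.

(* Companion matrix A(s) (0-indexed rows/columns i, j: paper's indices are i+1, j+1):
   A_{i,i+1} = 1 for i in [1,k-1], last row A_{k,j} = (-1)^(k-j) s_{k+1-j}. *)
Definition Amx (R : realType) (k : nat) (s : 'rV[CC R]_k) : 'M[CC R]_k :=
  \matrix_(i < k, j < k)
    if (i.+1 == k)%N then (-1) ^+ (k - j.+1) * scoef s (k - j)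
    else if (i.+1 == j)%N then 1 else 0.

Definition cint02pi (R : realType) (g : R -> CC R) : CC R :=
  (Rintegral (@lebesgue_measure R) `[0, 2 * pi]%classic (fun t => complex.Re (g t)))
  +i* (Rintegral (@lebesgue_measure R) `[0, 2 * pi]%classic (fun t => complex.Im (g t))).

(* contour integral over the circle |zeta| = r (counterclockwise) of a vector-valued
   function: zeta = r e^{i theta}, d zeta = i zeta d theta *)
Definition circle_int (R : realType) (k : nat) (r : R) (F : CC R -> 'cV[CC R]_k)
  : 'cV[CC R]_k :=
  \col_(i < k) cint02pi (fun t : R =>
     let z : CC R := (r * cos t) +i* (r * sin t) in F z i 0 * ((0 +i* 1) * z)).

(* A radius such that all roots of P_s lie in the open disc of that radius
   (Cauchy bound: every root z satisfies |z| <= max(1, sum |s_h|) < 1 + sum |s_h|). *)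
Definition rad (R : realType) (k : nat) (s : 'rV[CC R]_k) : R :=
  1 + \sum_(i < k) cmod (s 0 i).

Definition PhiF (R : realType) (k : nat) (f : CC R -> CC R) (s : 'rV[CC R]_k)
  : 'cV[CC R]_k :=
  (0 +i* (2 * pi))^-1 *: circle_int (rad s) (fun z => (f z / Ps s z) *: Evec k z).

Definition evec (R : realType) (k : nat) (h : nat) : 'rV[CC R]_k :=
  \row_(i < k) if (i.+1 == h)%N then 1 else 0.

Definition pd (R : realType) (k : nat) (h : nat) (F : 'rV[CC R]_k -> 'cV[CC R]_k)
  : 'rV[CC R]_k -> 'cV[CC R]_k :=
  'D_(evec R k h) F.

Definition holo (R : realType) (k : nat) (F : 'rV[CC R]_k -> 'cV[CC R]_k) : Prop :=
  forall s, differentiable F s.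

Definition sysA (R : realType) (k : nat) (Phi : 'rV[CC R]_k -> 'cV[CC R]_k) : Prop :=
  forall (s : 'rV[CC R]_k) (h : nat), (1 <= h <= k - 1)%N ->
    (-1) ^+ (k + h) *: pd h Phi s = pd k (fun t => Amx t ^+ (k - h) *m Phi t) s.

(* Main.v *)
Require Import Defs.
From HB Require Import structures.
From mathcomp Require Import all_boot all_order all_algebra.
From mathcomp Require Import all_classical all_reals all_analysis.
From mathcomp Require Import complex.
From mathcomp Require Import zify ring lra.
Import Order.TTheory GRing.Theory Num.Theory.
Import numFieldNormedType.Exports.
Set Implicit Arguments. Unset Strict Implicit. Unset Printing Implicit Defensive.
Local Open Scope ring_scope.
Local Open Scope complex_scope.
Local Open Scope classical_set_scope.

(** For f entire, Goursat's bisection in polar coordinates makes the integral over |zeta| = r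
    independent of r, so near a given s the radius can be frozen; then
    1/P_(s+v) = 1/P_s - L_v/P_s^2 + O(|v|^2), where L_v = P_(s+v) - P_s is linear in v, gives
    holomorphy and the partial derivatives of Phi_f. As A(s) E(z) = z E(z) - P_s(z) e_k and
    the integral of f vanishes, A Phi_f = Phi_(zf), and (@) becomes an identity of integrands.
    For an arbitrary solution Phi, the Leibniz rule reduces the stability under A to
    (-1)^(k+h) dA/ds_h = (dA/ds_k) A^(k-h), and the formula for second derivatives is (@) for
    A^(k-h) Phi together with the symmetry of mixed derivatives. *)

(** * Complex modulus and complex-valued integrals *)

(** Differentiability is only pointwise: no complex derivative is assumed continuous. Hence
    Goursat's bisection in place of Green's formula, and for an arbitrary solution of the system the
    mixed derivatives must be shown to exist before they can be compared; Cauchy estimates on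
    two-variable slices do both. For [PhiF] the obstacle is that the radius [rad s] moves with [s]
    and depends on it only through moduli, so nothing can be differentiated before the radius is
    frozen. Polar coordinates turn an annulus into a single rectangle in (r, theta) whose two radial
    sides cancel by periodicity; the inner radius may be 0, which gives Cauchy's theorem on a disc
    as well. Constants are not sharp: integrals and increments are estimated through their real and
    imaginary parts, and the resulting factors 2 accumulate into the later 8 and 64. *)

Section ComplexModulus.
Variable R : realType.
Implicit Types z w : CC R.

(* The library embedding [x%:C] lands in [R[i]]; [rc] lands in the numFieldType [CC R]. *)
Definition rc (x : R) : CC R := x%:C.

Lemma rcD x y : rc (x + y) = rc x + rc y.
Proof. exact: (rmorphD (real_complex R)). Qed.

Lemma rcN x : rc (- x) = - rc x.
Proof. exact: (rmorphN (real_complex R)). Qed.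

Lemma rcB x y : rc (x - y) = rc x - rc y.
Proof. by rewrite rcD rcN. Qed.

Lemma rcM x y : rc (x * y) = rc x * rc y.
Proof. exact: (rmorphM (real_complex R)). Qed.

Lemma rc0 : rc 0 = 0. Proof. by []. Qed.

Lemma rc1 : rc 1 = 1. Proof. by []. Qed.

Lemma rcV x : rc x^-1 = (rc x)^-1.
Proof. exact: (fmorphV (real_complex R)). Qed.

Lemma rc_inj : injective rc.
Proof. exact: complexI. Qed.

Lemma ler_rc x y : (rc x <= rc y) = (x <= y).
Proof. exact: lecR. Qed.

Lemma ltr_rc x y : (rc x < rc y) = (x < y).
Proof. exact: ltcR. Qed.

Lemma rc_eq0 x : (rc x == 0) = (x == 0).
Proof. exact: (inj_eq rc_inj x 0). Qed.

Lemma normCE z : `|z| = rc (cmod z).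
Proof. exact: normc_def. Qed.

Lemma cmod_ge0 z : 0 <= cmod z.
Proof. exact: sqrtr_ge0. Qed.

Lemma cmodM z w : cmod (z * w) = cmod z * cmod w.
Proof. by apply: rc_inj; rewrite rcM -!normCE normrM. Qed.

Lemma cmodD z w : cmod (z + w) <= cmod z + cmod w.
Proof. by rewrite -ler_rc rcD -!normCE ler_normD. Qed.

Lemma cmodN z : cmod (- z) = cmod z.
Proof. by apply: rc_inj; rewrite -!normCE normrN. Qed.

Lemma cmodB z w : cmod (z - w) <= cmod z + cmod w.
Proof. by rewrite -(cmodN w) cmodD. Qed.

Lemma cmod_distC z w : cmod (z - w) = cmod (w - z).
Proof. by rewrite -cmodN opprB. Qed.

Lemma cmod0 : cmod (0 : CC R) = 0.
Proof. by apply: rc_inj; rewrite -normCE normr0. Qed.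

Lemma cmod1 : cmod (1 : CC R) = 1.
Proof. by apply: rc_inj; rewrite -normCE normr1. Qed.

Lemma cmodX z n : cmod (z ^+ n) = cmod z ^+ n.
Proof. by elim: n => [|n IH]; rewrite ?expr0 ?cmod1 // !exprS cmodM IH. Qed.

Lemma cmodV z : cmod z^-1 = (cmod z)^-1.
Proof. by apply: rc_inj; rewrite rcV -!normCE normfV. Qed.

Lemma cmod_sign n : cmod ((-1 : CC R) ^+ n) = 1.
Proof. by rewrite cmodX cmodN cmod1 expr1n. Qed.

Lemma cmod_real (x : R) : cmod (rc x) = `|x|.
Proof. by rewrite /cmod /= expr0n addr0 sqrtr_sqr. Qed.

Lemma cmod_eq0 z : (cmod z == 0) = (z == 0).
Proof.
by rewrite -rc_eq0 -normCE normr_eq0.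
Qed.

Lemma cmod_gt0 z : (0 < cmod z) = (z != 0).
Proof. by rewrite lt_neqAle cmod_ge0 andbT eq_sym cmod_eq0. Qed.

Lemma cmod_sum (I : Type) (r : seq I) (P : pred I) (F : I -> CC R) :
  cmod (\sum_(i <- r | P i) F i) <= \sum_(i <- r | P i) cmod (F i).
Proof.
elim/big_ind2: _ => [|x1 x2 y1 y2 h1 h2|//]; first by rewrite cmod0.
by rewrite (le_trans (cmodD _ _))// lerD.
Qed.

Lemma Re_le_cmod z : `|complex.Re z| <= cmod z.
Proof. by rewrite -sqrtr_sqr ler_wsqrtr // lerDl sqr_ge0. Qed.

Lemma Im_le_cmod z : `|complex.Im z| <= cmod z.
Proof. by rewrite -sqrtr_sqr ler_wsqrtr // lerDr sqr_ge0. Qed.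

Lemma cmod_i : cmod (0 +i* 1 : CC R) = 1.
Proof. by rewrite /cmod /= expr0n add0r expr1n sqrtr1. Qed.

Lemma cmod_le_ReIm z : cmod z <= `|complex.Re z| + `|complex.Im z|.
Proof.
have zE : z = rc (complex.Re z) + (0 +i* 1) * rc (complex.Im z).
  exact: complexE.
by rewrite {1}zE (le_trans (cmodD _ _)) // cmodM !cmod_real cmod_i mul1r.
Qed.

(** The norm of [CC R] takes its values in [CC R], so ball radii are complex numbers. A positive one
    has zero imaginary part, which allows real radii throughout. *)
Lemma nbhs_cmodP z (P : set (CC R)) :
  nbhs z P <-> exists2 d : R, 0 < d & forall w, cmod (w - z) < d -> P w.
Proof.
split.
  move=> /nbhs_ballP[e /= e0 eP].
  have er : e = rc (complex.Re e).
    by case: e e0 {eP} => a b; rewrite ltcE /= => /andP[/eqP -> _].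
  exists (complex.Re e); first by rewrite -ltr_rc -er.
  move=> w wz; apply: eP; rewrite /ball /= /ball_ normCE er ltr_rc.
  by rewrite cmod_distC.
move=> [d d0 dP]; apply/nbhs_ballP; exists (rc d); first by rewrite /= ltr_rc.
move=> w; rewrite /ball /= /ball_ normCE ltr_rc => wz; apply: dP.
by rewrite cmod_distC.
Qed.

Lemma nbhs0_cmodP (P : set (CC R)) :
  dnbhs 0 P <-> exists2 d : R, 0 < d & forall w, w != 0 -> cmod w < d -> P w.
Proof.
rewrite /dnbhs /within /=; split.
  move=> /nbhs_cmodP[d d0 dP]; exists d => // w w0 wd; apply: dP => //.
  by rewrite subr0.
move=> [d d0 dP]; apply/nbhs_cmodP; exists d => // w; rewrite subr0 => wd w0.
exact: dP.
Qed.

Lemma cvg_cmodP (T : Type) (F : set_system T) (FF : Filter F) (f : T -> CC R)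
    (l : CC R) :
  f @ F --> l <-> forall e : R, 0 < e -> \forall x \near F, cmod (f x - l) < e.
Proof.
split.
  move=> fl e e0; apply: (fl [set w | cmod (w - l) < e]).
  by apply/nbhs_cmodP; exists e.
move=> h A /nbhs_cmodP[d d0 dA]; move: (h d d0); apply: filterS => x; exact: dA.
Qed.

Lemma continuous_ReC : continuous (fun z : CC R => complex.Re z).
Proof.
move=> z; apply/(@cvgrPdist_lt _ _ _ _ (nbhs_filter z)) => e e0; apply/nbhs_cmodP; exists e => // w wz /=.
by rewrite -raddfB (le_lt_trans (Re_le_cmod _)) // cmod_distC.
Qed.

Lemma continuous_ImC : continuous (fun z : CC R => complex.Im z).
Proof.
move=> z; apply/(@cvgrPdist_lt _ _ _ _ (nbhs_filter z)) => e e0; apply/nbhs_cmodP; exists e => // w wz /=.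
by rewrite -raddfB (le_lt_trans (Im_le_cmod _)) // cmod_distC.
Qed.

Lemma cvg_ReIm (T : Type) (F : set_system T) (FF : Filter F) (f g : T -> R)
    (a b : R) :
  f @ F --> a -> g @ F --> b ->
  (fun t => (f t +i* g t : CC R)) @ F --> (a +i* b : CC R).
Proof.
move=> /cvgrPdist_lt fa /cvgrPdist_lt gb; apply/cvg_cmodP => e e0.
have e20 : 0 < e / 2 by rewrite divr_gt0.
near=> t; rewrite (le_lt_trans (cmod_le_ReIm _)) //= (splitr e) ltrD //.
  by rewrite distrC; near: t; exact: fa.
by rewrite distrC; near: t; exact: gb.
Unshelve. all: by end_near. Qed.

End ComplexModulus.

(** * Integrals of complex functions over real segments, and derivatives of curves *)

Section ComplexIntegral.
Variable R : realType.
Local Notation mu := (@lebesgue_measure R).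
Implicit Types (g h G : R -> CC R) (a b : R).

(** Same encoding as [cint02pi], but over any segment, since the bisection integrates over pieces of
    the circle and of its radii. *)
Definition cint a b g : CC R :=
  (Rintegral mu `[a, b] (fun t => complex.Re (g t)))
  +i* (Rintegral mu `[a, b] (fun t => complex.Im (g t))).

(** Continuity is two-sided even at the endpoints: the integrands are compositions with curves
    defined on all of R. *)
Definition cts_on a b g := forall t, a <= t <= b -> {for t, continuous g}.

Lemma cts_on_Re_integrable a b g : cts_on a b g ->
  mu.-integrable `[a, b] (EFin \o (fun t => complex.Re (g t))).
Proof.
move=> cg; apply: continuous_compact_integrable; first exact: segment_compact.
apply: continuous_in_subspaceT => t; rewrite inE /= in_itv /= => /cg ct.
exact: (@continuous_comp _ _ _ g (fun z : CC R => complex.Re z) t ct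
  (@continuous_ReC R (g t))).
Qed.

Lemma cts_on_Im_integrable a b g : cts_on a b g ->
  mu.-integrable `[a, b] (EFin \o (fun t => complex.Im (g t))).
Proof.
move=> cg; apply: continuous_compact_integrable; first exact: segment_compact.
apply: continuous_in_subspaceT => t; rewrite inE /= in_itv /= => /cg ct.
exact: (@continuous_comp _ _ _ g (fun z : CC R => complex.Im z) t ct
  (@continuous_ImC R (g t))).
Qed.

Lemma eq_cint a b g h : (forall t, a <= t <= b -> g t = h t) ->
  cint a b g = cint a b h.
Proof.
move=> gh; congr (_ +i* _); apply: eq_Rintegral => t;
by rewrite inE /= in_itv /= => /gh ->.
Qed.

Lemma cts_onM a b g h : cts_on a b g -> cts_on a b h -> cts_on a b (fun t => g t * h t).
Proof. by move=> cg ch t tab; apply: continuousM; [exact: cg|exact: ch]. Qed.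

Lemma cts_on_cst a b (k : CC R) : cts_on a b (fun=> k).
Proof. by move=> t _; exact: cvg_cst. Qed.

Lemma cintD a b g h : cts_on a b g -> cts_on a b h ->
  cint a b (fun t => g t + h t) = cint a b g + cint a b h.
Proof.
move=> cg ch; rewrite /cint.
rewrite [RHS](_ : _ = (Rintegral mu `[a, b] (fun t => complex.Re (g t))
   + Rintegral mu `[a, b] (fun t => complex.Re (h t)))
  +i* (Rintegral mu `[a, b] (fun t => complex.Im (g t))
   + Rintegral mu `[a, b] (fun t => complex.Im (h t)))) //.
rewrite -!RintegralD //; do ?[exact: cts_on_Re_integrable|exact: cts_on_Im_integrable].
congr (_ +i* _); apply: eq_Rintegral => t _; case: (g t) => ? ?; case: (h t) => ? ? //.
Qed.

Lemma cintZ a b (k : CC R) g : cts_on a b g ->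
  cint a b (fun t => k * g t) = k * cint a b g.
Proof.
move=> cg; rewrite /cint; case: k => x y.
rewrite [RHS](_ : _ = (x * Rintegral mu `[a, b] (fun t => complex.Re (g t))
   - y * Rintegral mu `[a, b] (fun t => complex.Im (g t)))
  +i* (x * Rintegral mu `[a, b] (fun t => complex.Im (g t))
   + y * Rintegral mu `[a, b] (fun t => complex.Re (g t)))) //.
have iR := cts_on_Re_integrable cg; have iI := cts_on_Im_integrable cg.
have iZ (f : R -> R) (c : R) : mu.-integrable `[a, b] (EFin \o f) ->
    mu.-integrable `[a, b] (EFin \o (fun t => c * f t)).
  move=> fi; have := @integrableZl _ _ _ mu `[a, b] _ c (EFin \o f) fi.
  by apply => //.
rewrite -!RintegralZl // -RintegralB // -?RintegralD //; do ?[exact: iZ].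
by congr (_ +i* _); apply: eq_Rintegral => t _; case: (g t).
Qed.

Lemma cintN a b g : cts_on a b g -> cint a b (fun t => - g t) = - cint a b g.
Proof.
move=> cg; rewrite -mulN1r -cintZ //.
by apply: eq_cint => t _; rewrite mulN1r.
Qed.

Lemma cintB a b g h : cts_on a b g -> cts_on a b h ->
  cint a b (fun t => g t - h t) = cint a b g - cint a b h.
Proof.
move=> cg ch.
have cNh : cts_on a b (fun t => - h t).
  by move=> t tab; apply: continuousN; exact: ch.
by have E := cintN ch; rewrite -E; exact: (cintD cg cNh).
Qed.

Lemma Rintegral_bound a b (M : R) (f : R -> R) : a <= b ->
  mu.-integrable `[a, b] (EFin \o f) ->
  (forall t, a <= t <= b -> `|f t| <= M) ->
  `|Rintegral mu `[a, b] f| <= M * (b - a).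
Proof.
move=> ab fi fM; rewrite (le_trans (le_normr_Rintegral _ fi)) //.
have mE : fine (mu `[a, b]) = b - a.
  rewrite lebesgue_measure_itv /= lte_fin; case: ltP => // ba.
  by rewrite (le_anti (introT andP (conj ab ba))) subrr.
have iM : mu.-integrable `[a, b] (EFin \o (fun=> M)).
  apply: continuous_compact_integrable; first exact: segment_compact.
  by apply: continuous_in_subspaceT => t _; exact: cst_continuous.
have iN : mu.-integrable `[a, b] (EFin \o (fun t => `|f t|)).
  exact: integrable_norm.
rewrite -mE -Rintegral_cst //; by apply: le_Rintegral.
Qed.

(** The factor 2 is the price of bounding the real and imaginary parts separately; only orders of
    magnitude matter later. *)
Lemma cint_bound a b (M : R) g : a <= b -> cts_on a b g ->
  (forall t, a <= t <= b -> cmod (g t) <= M) ->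
  cmod (cint a b g) <= 2 * M * (b - a).
Proof.
move=> ab cg gM; rewrite (le_trans (cmod_le_ReIm _)) //=.
rewrite (_ : 2 * M * (b - a) = M * (b - a) + M * (b - a)); last by ring.
apply: lerD; apply: Rintegral_bound => //;
  do ?[exact: cts_on_Re_integrable|exact: cts_on_Im_integrable] => t /gM.
  exact: le_trans (Re_le_cmod _).
exact: le_trans (Im_le_cmod _).
Qed.

Lemma Rintegral_split a m b (f : R -> R) : a <= m -> m <= b ->
  mu.-integrable `[a, b] (EFin \o f) ->
  Rintegral mu `[a, b] f = Rintegral mu `[a, m] f + Rintegral mu `[m, b] f.
Proof.
move=> am mb fi.
rewrite -(@Rintegral_itv_obnd_cbnd _ m (BRight b)); last first.
  apply: integrableS fi => //; apply: subset_itv; rewrite bnd_simp //.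
by rewrite -(Rintegral_itvB fi) ?bnd_simp // addrC subrK.
Qed.

Lemma cint_split a m b g : a <= m -> m <= b -> cts_on a b g ->
  cint a b g = cint a m g + cint m b g.
Proof.
move=> am mb cg; rewrite /cint (@Rintegral_split a m b _ am mb); last first.
  exact: cts_on_Re_integrable.
by rewrite (@Rintegral_split a m b _ am mb) //; exact: cts_on_Im_integrable.
Qed.

(** Derivative of a curve from R to C, split into components so that the real derivation rules and
    the real fundamental theorem of calculus apply to each. *)
Definition is_cderiv G (t : R) (l : CC R) :=
  is_derive t 1 (fun x => complex.Re (G x)) (complex.Re l) /\
  is_derive t 1 (fun x => complex.Im (G x)) (complex.Im l).

Lemma is_cderiv_cts G t l : is_cderiv G t l -> {for t, continuous G}.
Proof.
move=> [[dR _] [dI _]].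
have cR := differentiable_continuous ((derivable1_diffP _ _).1 dR).
have cI := differentiable_continuous ((derivable1_diffP _ _).1 dI).
rewrite /prop_for /continuous_at.
rewrite (_ : G = fun x => complex.Re (G x) +i* complex.Im (G x)); last first.
  by apply/funext => x; case: (G x).
exact: cvg_ReIm cR cI.
Qed.

Lemma is_cderivD G H t l m : is_cderiv G t l -> is_cderiv H t m ->
  is_cderiv (fun x => G x + H x) t (l + m).
Proof.
move=> [gR gI] [hR hI]; split.
- have -> : (fun x => complex.Re (G x + H x)) =
    (fun x => complex.Re (G x)) \+ (fun x => complex.Re (H x)).
    by apply/funext => x /=; case: (G x) => ? ?; case: (H x).
  by apply: is_derive_eq; case: (l) => ? ?; case: (m).
- have -> : (fun x => complex.Im (G x + H x)) =
    (fun x => complex.Im (G x)) \+ (fun x => complex.Im (H x)).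
    by apply/funext => x /=; case: (G x) => ? ?; case: (H x).
  by apply: is_derive_eq; case: (l) => ? ?; case: (m).
Qed.

Lemma is_cderivM G H t l m : is_cderiv G t l -> is_cderiv H t m ->
  is_cderiv (fun x => G x * H x) t (l * H t + G t * m).
Proof.
move=> [gR gI] [hR hI]; split.
- have -> : (fun x => complex.Re (G x * H x)) =
    (fun x => complex.Re (G x)) * (fun x => complex.Re (H x)) -
    (fun x => complex.Im (G x)) * (fun x => complex.Im (H x)).
    by apply/funext => x; rewrite !fctE; case: (G x) => ? ?; case: (H x).
  apply: is_derive_eq (is_deriveB (is_deriveM gR hR) (is_deriveM gI hI)) _.
  rewrite /GRing.scale /=.
  case: (G t) => a1 a2; case: (H t) => b1 b2; case: (l) => c1 c2; case: (m) => d1 d2 /=.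
  by ring.
- have -> : (fun x => complex.Im (G x * H x)) =
    (fun x => complex.Re (G x)) * (fun x => complex.Im (H x)) +
    (fun x => complex.Im (G x)) * (fun x => complex.Re (H x)).
    by apply/funext => x; rewrite !fctE; case: (G x) => ? ?; case: (H x).
  apply: is_derive_eq; rewrite /GRing.scale /=.
  case: (G t) => a1 a2; case: (H t) => b1 b2; case: (l) => c1 c2; case: (m) => d1 d2 /=.
  by ring.
Qed.

Lemma is_cderiv_cst (k : CC R) t : is_cderiv (fun=> k) t 0.
Proof. by split; exact: is_derive_cst. Qed.

Lemma is_cderiv_eq G t l m : is_cderiv G t l -> l = m -> is_cderiv G t m.
Proof. by move=> ? <-. Qed.

Lemma is_cderivZ (k : CC R) G t l : is_cderiv G t l ->
  is_cderiv (fun x => k * G x) t (k * l).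
Proof.
move=> dG; apply: is_cderiv_eq (is_cderivM (is_cderiv_cst k t) dG) _.
by rewrite mul0r add0r.
Qed.

Lemma Rintegral_FTC a b (f F : R -> R) : a <= b ->
  (forall t : R, is_derive t 1 F (f t)) ->
  (forall t, a <= t <= b -> {for t, continuous f}) ->
  Rintegral mu `[a, b] f = F b - F a.
Proof.
rewrite le_eqVlt => /orP[/eqP <-|ab] dF cf.
  by rewrite set_itv1 Rintegral_set1 subrr.
have cF t : {for t, continuous F}.
  exact: differentiable_continuous ((derivable1_diffP _ _).1 (@ex_derive _ _ _ _ _ _ _ (dF t))).
rewrite /Rintegral (@continuous_FTC2 _ f F) //.
- by apply: continuous_in_subspaceT => t; rewrite inE /= in_itv /= => /cf.
- split.
  + by move=> t _; have [] := dF t.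
  + exact: cvg_at_right_filter (cF a).
  + exact: cvg_at_left_filter (cF b).
- by move=> t _; rewrite derive1E; have [] := dF t.
Qed.

Lemma cint_FTC a b g G : a <= b -> (forall t, is_cderiv G t (g t)) ->
  cts_on a b g -> cint a b g = G b - G a.
Proof.
move=> ab dG cg.
have eR : Rintegral mu `[a, b] (fun t => complex.Re (g t)) =
    complex.Re (G b) - complex.Re (G a).
  apply: (Rintegral_FTC (F := fun x => complex.Re (G x))) => // [t|t /cg ct].
    by have [] := dG t.
  exact: (@continuous_comp _ _ _ g (fun z : CC R => complex.Re z) t ct
    (@continuous_ReC R (g t))).
have eI : Rintegral mu `[a, b] (fun t => complex.Im (g t)) =
    complex.Im (G b) - complex.Im (G a).
  apply: (Rintegral_FTC (F := fun x => complex.Im (G x))) => // [t|t /cg ct].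
    by have [] := dG t.
  exact: (@continuous_comp _ _ _ g (fun z : CC R => complex.Im z) t ct
    (@continuous_ImC R (g t))).
by rewrite /cint eR eI; case: (G b) => ? ?; case: (G a).
Qed.

End ComplexIntegral.

(** * Goursat's theorem in polar coordinates *)

Section Bisection.
Variable R : realType.

Lemma nested_itv_point (a b : nat -> R) :
  (forall n, a n <= a n.+1) -> (forall n, b n.+1 <= b n) -> (forall n, a n <= b n) ->
  exists x, forall n, a n <= x <= b n.
Proof.
move=> ha hb hab.
have ma m n : (m <= n)%N -> a m <= a n.
  by move=> /subnKC <-; elim: (n - m)%N => [|k IH]; rewrite ?addn0 // addnS (le_trans IH).
have mb m n : (m <= n)%N -> b n <= b m.
  by move=> /subnKC <-; elim: (n - m)%N => [|k IH]; rewrite ?addn0 // addnS (le_trans _ IH).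
have hmn m n : a m <= b n.
  by rewrite (le_trans (ma _ (maxn m n) (leq_maxl _ _))) // (le_trans (hab _)) // mb // leq_maxr.
exists (sup (range a)) => n; apply/andP; split.
  apply: ub_le_sup; last by exists n.
  by exists (b 0%N) => _ [m _ <-].
by apply: ge_sup; [exists (a 0%N); exists 0%N|move=> _ [m _ <-]].
Qed.

Lemma ex_div2n_lt (L d : R) : 0 <= L -> 0 < d -> exists n, L / 2 ^+ n < d.
Proof.
move=> L0 d0; exists (Num.truncn (L / d)).+1; rewrite ltr_pdivrMr ?exprn_gt0 //.
rewrite mulrC -ltr_pdivrMr // (lt_trans (truncnS_gt _)) //.
by rewrite -natrX ltr_nat ltn_expl.
Qed.

(** [I a b c d] stands for an integral along the boundary of [a, b] x [c, d]. Goursat's argument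
    uses only additivity under cutting in either direction and the bound [local_small], which is
    o(size^2) at each point. *)
Variable I : R -> R -> R -> R -> CC R.
Variables A B C D : R.
Hypotheses (AB : A <= B) (CD : C <= D).
Hypothesis additive_x : forall a m b c d,
  A <= a -> a <= m -> m <= b -> b <= B -> C <= c -> c <= d -> d <= D ->
  I a b c d = I a m c d + I m b c d.
Hypothesis additive_y : forall a b c m d,
  A <= a -> a <= b -> b <= B -> C <= c -> c <= m -> m <= d -> d <= D ->
  I a b c d = I a b c m + I a b m d.
Hypothesis local_small : forall x y, A <= x <= B -> C <= y <= D ->
  forall e : R, 0 < e -> exists2 del : R, 0 < del & forall a b c d,
    A <= a -> a <= x -> x <= b -> b <= B -> C <= c -> c <= y -> y <= d -> d <= D ->
    b - a < del -> d - c < del ->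
    cmod (I a b c d) <= e * ((b - a) + (d - c)) ^+ 2.

Let rect := (R * R * R * R)%type.
Let val (q : rect) := let: (a, b, c, d) := q in cmod (I a b c d).
Let good (n : nat) (q : rect) := let: (a, b, c, d) := q in
  [/\ A <= a, a <= b, b <= B, b - a = (B - A) / 2 ^+ n &
   [/\ C <= c, c <= d, d <= D & d - c = (D - C) / 2 ^+ n]].
Let sub (q q' : rect) := let: (a, b, c, d) := q in let: (a', b', c', d') := q' in
  [/\ a <= a', b' <= b, c <= c' & d' <= d].
(** The first quarter carrying at least a quarter of the modulus. The last quarter is a default
    value, and [nextP] shows that it qualifies when the other three fail. *)
Let next (q : rect) : rect := let: (a, b, c, d) := q in
  let m := (a + b) / 2 in let p := (c + d) / 2 in
  if val q <= 4 * val (a, m, c, p) then (a, m, c, p) else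
  if val q <= 4 * val (m, b, c, p) then (m, b, c, p) else
  if val q <= 4 * val (a, m, p, d) then (a, m, p, d) else (m, b, p, d).

Let halve (n : nat) (a b L : R) : a <= b -> b - a = L / 2 ^+ n ->
  [/\ a <= (a + b) / 2, (a + b) / 2 <= b, (a + b) / 2 - a = L / 2 ^+ n.+1 &
      b - (a + b) / 2 = L / 2 ^+ n.+1].
Proof.
move=> ab h; have E : L / 2 ^+ n.+1 = (b - a) / 2.
  by rewrite h exprS invfM mulrCA mulrC.
by rewrite E; split; lra.
Qed.

Let nextP n q : good n q ->
  [/\ good n.+1 (next q), sub q (next q) & val q <= 4 * val (next q)].
Proof.
case: q => [[[a b] c] d] [Aa ab bB eab [Cc cd dD ecd]].
have [h1 h2 h3 h4] := halve ab eab; have [k1 k2 k3 k4] := halve cd ecd.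
set m := (a + b) / 2 in h1 h2 h3 h4 *; set p := (c + d) / 2 in k1 k2 k3 k4 *.
rewrite /next -/m -/p.
have mB := le_trans h2 bB; have Am := le_trans Aa h1.
have pD := le_trans k2 dD; have Cp := le_trans Cc k1.
case: ifPn => c1; first by split.
case: ifPn => c2; first by split.
case: ifPn => c3; first by split.
split=> //.
(* If three quarters each carry less than a fourth of the whole, additivity and the triangle
   inequality leave at least a fourth to the remaining one. *)
move: c1 c2 c3; rewrite -!ltNge /val => c1 c2 c3.
have E : I a b c d = (I a m c p + I m b c p) + (I a m p d + I m b p d).
  rewrite (@additive_y a b c p d) // (@additive_x a m b c p) //.
  by rewrite (@additive_x a m b p d).
have : cmod (I a b c d) <= cmod (I a m c p) + cmod (I m b c p) +
    (cmod (I a m p d) + cmod (I m b p d)).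
  rewrite {1}E (le_trans (cmodD _ _)) // lerD // cmodD //.
move: c1 c2 c3; lra.
Qed.

Let Q n := iter n next (A, B, C, D).

Let goodQ n : good n (Q n).
Proof.
elim: n => [|n IH]; first by rewrite /good /= expr0 !divr1; split=> //; split.
by have [] := nextP IH.
Qed.

Let valQ n : val (A, B, C, D) <= 4 ^+ n * val (Q n).
Proof.
elim: n => [|n IH]; first by rewrite expr0 mul1r.
rewrite (le_trans IH) // exprSr -mulrA ler_wpM2l ?exprn_ge0 //.
by have [] := nextP (goodQ n).
Qed.

(* Goursat's bisection argument, for an arbitrary additive rectangle function. *)
Lemma additive_rect_eq0 : I A B C D = 0.
Proof.
apply/eqP; rewrite -cmod_eq0; apply/negP => /negP M0.
set M := cmod (I A B C D) in M0.
have {}M0 : 0 < M by rewrite lt_neqAle eq_sym M0 cmod_ge0.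
pose a n := (Q n).1.1.1; pose b n := (Q n).1.1.2.
pose c n := (Q n).1.2; pose d n := (Q n).2.
have QE n : Q n = (a n, b n, c n, d n).
  by rewrite /a /b /c /d; case: (Q n) => [[[? ?] ?] ?].
have gQ n := goodQ n.
have sQ n : sub (Q n) (Q n.+1) by have [] := nextP (gQ n).
have [x hx] : exists x, forall n, a n <= x <= b n.
  apply: nested_itv_point => n.
  - by have := sQ n; rewrite !QE => -[].
  - by have := sQ n; rewrite !QE => -[].
  - by have := gQ n; rewrite !QE => -[].
have [y hy] : exists y, forall n, c n <= y <= d n.
  apply: nested_itv_point => n.
  - by have := sQ n; rewrite !QE => -[].
  - by have := sQ n; rewrite !QE => -[].
  - by have := gQ n; rewrite !QE => -[_ _ _ _ []].
pose L := (B - A) + (D - C).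
have L0 : 0 <= L by rewrite addr_ge0 // subr_ge0.
(* With this tolerance the factor 4^n cancels the squared size (L / 2^n)^2, and what remains is M <=
   M * (L^2 / (L^2 + 1)), absurd for M > 0. The +1 keeps the denominator nonzero when L = 0. *)
have e0 : 0 < M / (L ^+ 2 + 1) by rewrite divr_gt0 // ltr_wpDl // sqr_ge0.
have [del del0 hdel] := local_small (hx 0%N) (hy 0%N) e0.
have [n hn] := ex_div2n_lt L0 del0.
have := gQ n; rewrite QE => -[h1 h2 h3 h4 [k1 k2 k3 k4]].
have /andP[ax xb] := hx n; have /andP[cy yd] := hy n.
have tn : 0 < (2 ^+ n : R) by rewrite exprn_gt0.
have hba : b n - a n < del.
  rewrite h4 (le_lt_trans _ hn) // ler_pM2r ?invr_gt0 // lerDl subr_ge0 //.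
have H := hdel _ _ _ _ h1 ax xb h3 k1 cy yd k3 hba.
have : cmod (I (a n) (b n) (c n) (d n)) <= M / (L ^+ 2 + 1) * (L / 2 ^+ n) ^+ 2.
  have -> : L / 2 ^+ n = b n - a n + (d n - c n) by rewrite h4 k4 -mulrDl.
  apply: H; rewrite k4 (le_lt_trans _ hn) // ler_pM2r ?invr_gt0 // lerDr subr_ge0 //.
move=> H1; have := valQ n; rewrite QE /val -/M => H2.
have f0 : 0 < (4 ^+ n : R) by rewrite exprn_gt0.
have : M <= 4 ^+ n * (M / (L ^+ 2 + 1) * (L / 2 ^+ n) ^+ 2).
  by rewrite (le_trans H2) // ler_pM2l.
have -> : 4 ^+ n * (M / (L ^+ 2 + 1) * (L / 2 ^+ n) ^+ 2) = M * (L ^+ 2 / (L ^+ 2 + 1)).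
  rewrite expr_div_n -exprM mulnC exprM (_ : 2 ^+ 2 = 4 :> R); last by ring.
  by field; rewrite !lt0r_neq0 ?ltr_wpDl ?sqr_ge0.
rewrite -[X in X <= _]mulr1 ler_pM2l // ler_pdivlMr ?ltr_wpDl ?sqr_ge0 //.
by rewrite mul1r gerDl ler10.
Qed.

End Bisection.

(** * Boundary integrals of polar rectangles and independence of the radius *)

Section PolarGoursat.
Variable R : realType.
Implicit Types (F G : CC R -> CC R) (z w : CC R).
Local Notation I1 := (0 +i* 1 : CC R).

Definition pol (r t : R) : CC R := (r * cos t) +i* (r * sin t).

Lemma cmod_pol r t : 0 <= r -> cmod (pol r t) = r.
Proof.
move=> r0; rewrite /cmod /pol /= !exprMn -mulrDr cos2Dsin2 mulr1.
by rewrite sqrtr_sqr ger0_norm.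
Qed.

Lemma pol_rc r t : pol r t = rc r * pol 1 t.
Proof. by congr (_ +i* _); rewrite /= !mul1r !mul0r ?subr0 ?addr0. Qed.

Lemma pol0 t : pol 0 t = 0.
Proof. by rewrite pol_rc mul0r. Qed.

Lemma polB r s t : pol r t - pol s t = pol (r - s) t.
Proof. by rewrite pol_rc (pol_rc s) (pol_rc (r - s)) rcB mulrBl. Qed.

Lemma pol_2pi r : pol r (2 * pi) = pol r 0.
Proof.
rewrite /pol (_ : 2 * pi = 0 + pi + pi); last by ring.
by rewrite !cosDpi !sinDpi !opprK.
Qed.

Lemma is_cderiv_pol_angle r t : is_cderiv (fun x => pol r x) t (I1 * pol r t).
Proof.
split; rewrite /pol /=.
- have -> : (fun x => r * cos x) = r *: (@cos R) by [].
  apply: is_derive_eq; rewrite /GRing.scale /=; ring.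
- have -> : (fun x => r * sin x) = r *: (@sin R) by [].
  apply: is_derive_eq; rewrite /GRing.scale /=; ring.
Qed.

Lemma is_cderiv_pol_radius (x t : R) : is_cderiv (fun x => pol x t) x (pol 1 t).
Proof.
split; rewrite /pol /=.
- have -> : (fun x => x * cos t) = cos t *: (@idfun R).
    by apply/funext => y; rewrite fctE /GRing.scale /= mulrC.
  by apply: is_derive_eq; rewrite /GRing.scale /= mulr1 mul1r.
- have -> : (fun x => x * sin t) = sin t *: (@idfun R).
    by apply/funext => y; rewrite fctE /GRing.scale /= mulrC.
  by apply: is_derive_eq; rewrite /GRing.scale /= mulr1 mul1r.
Qed.

Lemma cts_pol_angle r t : {for t, continuous (fun x => pol r x)}.
Proof. exact: is_cderiv_cts (is_cderiv_pol_angle r t). Qed.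

Lemma cts_pol_radius (x t : R) : {for x, continuous (fun x => pol x t)}.
Proof. exact: is_cderiv_cts (is_cderiv_pol_radius x t). Qed.

Lemma pol_angle_lipschitz r s t : 0 <= r -> cmod (pol r t - pol r s) <= 2 * r * `|t - s|.
Proof.
move=> r0; wlog st : s t / s <= t => [h|].
  by have [/h //|/ltW/h] := leP s t; rewrite cmod_distC distrC.
have ci : cts_on s t (fun x => I1 * pol r x).
  by apply: cts_onM; [exact: cts_on_cst|move=> x _; exact: cts_pol_angle].
rewrite -(cint_FTC st (is_cderiv_pol_angle r)) // ger0_norm ?subr_ge0 //.
by apply: cint_bound => // x _; rewrite cmodM cmod_i mul1r cmod_pol.
Qed.

Lemma pol_dist r s t u : 0 <= s -> cmod (pol r t - pol s u) <= `|r - s| + 2 * s * `|t - u|.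
Proof.
move=> s0; have -> : pol r t - pol s u = (pol r t - pol s t) + (pol s t - pol s u).
  by rewrite addrA subrK.
rewrite (le_trans (cmodD _ _)) // lerD ?pol_angle_lipschitz //.
by rewrite polB pol_rc cmodM cmod_real cmod_pol // mulr1.
Qed.

Lemma derivable_expansion F z : derivable F z 1 ->
  forall e : R, 0 < e -> exists2 d : R, 0 < d & forall w, cmod (w - z) < d ->
    cmod (F w - (F z + 'D_1 F z * (w - z))) <= e * cmod (w - z).
Proof.
move=> dF e e0.
have /cvg_cmodP/(_ e e0)/nbhs0_cmodP[d d0 H] := dF.
exists d => // w wz; have [->|wz0] := eqVneq w z.
  by rewrite !subrr mulr0 addr0 subrr cmod0 mulr0.
have h0 : w - z != 0 by rewrite subr_eq0.
have := H _ h0 wz; rewrite /GRing.scale /= mulr1 subrK => /ltW H1.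
have -> : F w - (F z + 'D_1 F z * (w - z)) =
    ((w - z)^-1 * (F w - F z) - 'D_1 F z) * (w - z).
  by field.
by rewrite cmodM ler_wpM2r // cmod_ge0.
Qed.

Lemma derivable_cts F z : derivable F z 1 -> {for z, continuous F}.
Proof. by move=> /derivable1_diffP/differentiable_continuous. Qed.

Definition cI (r : R) F : CC R := cint 0 (2 * pi) (fun t => F (pol r t) * (I1 * pol r t)).

Definition arc_int F r c d := cint c d (fun t => F (pol r t) * (I1 * pol r t)).
Definition ray_int F t a b := cint a b (fun x => F (pol x t) * pol 1 t).
(** Integral of F dz along the positively oriented boundary of the polar rectangle a <= r <= b, c <=
    theta <= d. The factors in [arc_int] and [ray_int] are the partial derivatives of [pol] in the
    angle and in the radius. *)
Definition sector_int F a b c d :=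
  (arc_int F b c d - arc_int F a c d) - (ray_int F d a b - ray_int F c a b).

Lemma arc_cts F r c d : (forall t, c <= t <= d -> {for pol r t, continuous F}) ->
  cts_on c d (fun t => F (pol r t) * (I1 * pol r t)).
Proof.
move=> cF; apply: cts_onM; last first.
  by apply: cts_onM; [exact: cts_on_cst|move=> x _; exact: cts_pol_angle].
move=> t /cF ct.
exact: (@continuous_comp _ _ _ (pol r) F t (@cts_pol_angle r t) ct).
Qed.

Lemma ray_cts F t a b : (forall x, a <= x <= b -> {for pol x t, continuous F}) ->
  cts_on a b (fun x => F (pol x t) * pol 1 t).
Proof.
move=> cF; apply: cts_onM; last exact: cts_on_cst.
move=> x /cF cx.
exact: (@continuous_comp _ _ _ (pol^~ t) F x (@cts_pol_radius x t) cx).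
Qed.

Lemma cts_affine (p q : CC R) z : {for z, continuous (fun w => p + q * w)}.
Proof.
apply: continuousD; first exact: (@cst_continuous _ _ p z).
apply: continuousM; last exact: cvg_id.
exact: (@cst_continuous _ _ q z).
Qed.

(** An affine function has the explicit primitive [W], so each side contributes a difference of
    corner values, and these cancel around the boundary. *)
Lemma sector_int_affine (p q : CC R) a b c d : a <= b -> c <= d ->
  sector_int (fun w => p + q * w) a b c d = 0.
Proof.
move=> ab cd; pose W w := p * w + (q / 2) * (w * w).
have two0 : (2 : CC R) != 0 by rewrite pnatr_eq0.
have dW (f : R -> CC R) t l : is_cderiv f t l ->
    is_cderiv (fun x => W (f x)) t ((p + q * f t) * l).
  move=> df; apply: is_cderiv_eq.
    apply: is_cderivD; first exact: is_cderivZ df.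
    exact: is_cderivZ (is_cderivM df df).
  by field.
have arcE r : arc_int (fun w => p + q * w) r c d = W (pol r d) - W (pol r c).
  apply: (cint_FTC (G := fun t => W (pol r t))) => // [t|].
    exact: (dW _ _ _ (is_cderiv_pol_angle r t)).
  by apply: (@arc_cts (fun w => p + q * w)) => t _; exact: cts_affine.
have rayE t : ray_int (fun w => p + q * w) t a b = W (pol b t) - W (pol a t).
  apply: (cint_FTC (G := fun x => W (pol x t))) => // [x|].
    exact: (dW _ _ _ (is_cderiv_pol_radius x t)).
  by apply: (@ray_cts (fun w => p + q * w)) => x _; exact: cts_affine.
by rewrite /sector_int !arcE !rayE; ring.
Qed.

Section Annulus.
Variables (F : CC R -> CC R) (A B : R).
Hypotheses (A0 : 0 <= A) (AB : A <= B).
Hypothesis dF : forall z, A <= cmod z <= B -> derivable F z 1.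

Let cF r t : A <= r <= B -> {for pol r t, continuous F}.
Proof.
move=> /andP[Ar rB]; apply: derivable_cts; apply: dF.
by rewrite cmod_pol ?Ar // (le_trans A0).
Qed.

(** Subtracting the tangent affine map at [pol x y] does not change the boundary integral. What is
    left is o(s) on sides of length O(s), where s is the sum of the side lengths in (r, theta). *)
Lemma sector_int_local x y (C D : R) : A <= x <= B -> C <= y <= D ->
  forall e : R, 0 < e -> exists2 del : R, 0 < del & forall a b c d,
    A <= a -> a <= x -> x <= b -> b <= B -> C <= c -> c <= y -> y <= d -> d <= D ->
    b - a < del -> d - c < del ->
    cmod (sector_int F a b c d) <= e * ((b - a) + (d - c)) ^+ 2.
Proof.
move=> /andP[Ax xB] CyD e e0; set z := pol x y.
have x0 : 0 <= x by exact: le_trans Ax.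
have B0 : 0 <= B by exact: le_trans xB.
have zAB : A <= cmod z <= B by rewrite cmod_pol // Ax.
(* By [pol_dist], every point of the small sector is within K * s of z. *)
pose K := 1 + 2 * B; have K0 : 0 < K by rewrite ltr_pwDl // mulr_ge0.
(* Two arcs and two rays, each bounded by [cint_bound], add up to at most 4 * eta * K * (B + 1) *
   s^2; this must equal e * s^2. *)
have eta0 : 0 < e / (4 * K * (B + 1)) by rewrite divr_gt0 // !mulr_gt0 // ltr_wpDl.
have [del del0 hdel] := derivable_expansion (dF zAB) eta0.
set eta := e / _ in eta0 hdel.
exists (del / (2 * K)); first by rewrite divr_gt0 // mulr_gt0.
move=> a b c d Aa ax xb bB Cc cy yd dD ba dc.
have ab := le_trans ax xb; have cd := le_trans cy yd.
set s := b - a + (d - c).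
have s0 : 0 <= s by rewrite addr_ge0 // subr_ge0.
have sdel : K * s < del.
  have -> : del = K * (del / (2 * K) + del / (2 * K)) by field; rewrite lt0r_neq0.
  by rewrite ltr_pM2l // ltrD.
pose l := 'D_1 F z; pose p := F z - l * z.
pose N w := p + l * w; pose G w := F w - N w.
have GE w : G w = F w - (F z + l * (w - z)) by rewrite /G /N /p; ring.
have near_z u v : a <= u <= b -> c <= v <= d -> cmod (pol u v - z) <= K * s.
  move=> /andP[au ub] /andP[cv vd].
  have -> : K * s = s + 2 * B * s by rewrite /K; ring.
  rewrite (le_trans (pol_dist u v y x0)) //.
  have h1 : `|u - x| <= s.
    rewrite (@le_trans _ _ (b - a)) ?lerDl ?subr_ge0 //.
    rewrite ler_norml opprB; apply/andP; split; lra.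
  have h2 : `|v - y| <= s.
    rewrite (@le_trans _ _ (d - c)) ?lerDr ?subr_ge0 //.
    rewrite ler_norml opprB; apply/andP; split; lra.
  by rewrite lerD // ler_pM // ?mulr_ge0 // ler_wpM2l.
have Gsmall u v : a <= u <= b -> c <= v <= d -> cmod (G (pol u v)) <= eta * (K * s).
  move=> hu hv; have h := near_z u v hu hv.
  rewrite GE (le_trans (hdel _ (le_lt_trans h sdel))) //.
  by rewrite ler_wpM2l // ltW.
have cG u v : a <= u <= b -> {for pol u v, continuous G}.
  move=> /andP[au ub]; apply: continuousB; last exact: cts_affine.
  by apply: cF; rewrite (le_trans Aa) // (le_trans ub).
have cFab u v : a <= u <= b -> {for pol u v, continuous F}.
  by move=> /andP[au ub]; apply: cF; rewrite (le_trans Aa) // (le_trans ub).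
have aab : a <= a <= b by rewrite lexx.
have bab : a <= b <= b by rewrite lexx andbT.
have ccd : c <= c <= d by rewrite lexx.
have dcd : c <= d <= d by rewrite lexx andbT.
have arcG u : a <= u <= b -> arc_int G u c d = arc_int F u c d - arc_int N u c d.
  move=> hu; rewrite /arc_int -cintB.
  - by apply: eq_cint => t _; rewrite -mulrBl.
  - by apply: arc_cts => t _; exact: cFab.
  - by apply: (@arc_cts (fun w => p + l * w)) => t _; exact: cts_affine.
have rayG v : ray_int G v a b = ray_int F v a b - ray_int N v a b.
  rewrite /ray_int -cintB.
  - by apply: eq_cint => t _; rewrite -mulrBl.
  - by apply: ray_cts => t ?; exact: cFab.
  - by apply: (@ray_cts (fun w => p + l * w)) => t _; exact: cts_affine.
have sE : sector_int F a b c d = sector_int G a b c d.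
  have := sector_int_affine p l ab cd; rewrite -/N /sector_int !arcG // !rayG => N0.
  by rewrite -[LHS]subr0 -N0; ring.
have arcb u : a <= u <= b -> cmod (arc_int G u c d) <= 2 * (eta * (K * s) * B) * (d - c).
  move=> hu; have /andP[au ub] := hu; apply: cint_bound => //.
    by apply: arc_cts => t _; exact: cG.
  move=> t ht; have u0 : 0 <= u by rewrite (le_trans A0) // (le_trans Aa).
  rewrite !cmodM cmod_i mul1r cmod_pol // ler_pM ?cmod_ge0 ?Gsmall //.
  exact: le_trans bB.
have rayb v : c <= v <= d -> cmod (ray_int G v a b) <= 2 * (eta * (K * s)) * (b - a).
  move=> hv; apply: cint_bound => //.
    by apply: ray_cts => t ?; exact: cG.
  by move=> t ht; rewrite cmodM cmod_pol // mulr1 Gsmall.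
rewrite sE /sector_int (le_trans (cmodB _ _)) //.
have := cmodB (arc_int G b c d) (arc_int G a c d).
have := cmodB (ray_int G d a b) (ray_int G c a b).
have := arcb _ aab; have := arcb _ bab; have := rayb _ ccd; have := rayb _ dcd.
have : 4 * (eta * (K * s) * B) * (d - c) + 4 * (eta * (K * s)) * (b - a) <= e * s ^+ 2.
  have -> : e = 4 * eta * K * (B + 1).
    by rewrite /eta; field; rewrite !lt0r_neq0 // ltr_wpDl.
  have -> : 4 * eta * K * (B + 1) * s ^+ 2 =
    4 * (eta * (K * s)) * (B * s) + 4 * (eta * (K * s)) * s by ring.
  have eta1 := ltW eta0; have K1 := ltW K0.
  have E0 : 0 <= 4 * (eta * (K * s)).
    by apply: mulr_ge0 => //; apply: mulr_ge0 => //; apply: mulr_ge0.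
  apply: lerD; last by rewrite ler_wpM2l // lerDl subr_ge0.
  rewrite (_ : 4 * (_ * B) * _ = 4 * (eta * (K * s)) * (B * (d - c))); last by ring.
  by rewrite ler_wpM2l // ler_wpM2l // lerDr subr_ge0.
lra.
Qed.

Lemma cI_deform : cI A F = cI B F.
Proof.
have pi0 : 0 <= 2 * pi :> R by rewrite mulr_ge0 // pi_ge0.
have s0 : sector_int F A B 0 (2 * pi) = 0.
  apply: (additive_rect_eq0 (I := sector_int F)) => //.
  - move=> a m b c d Aa am mb bB _ cd _; rewrite /sector_int.
    rewrite /ray_int (@cint_split _ a m b _ am mb); last first.
      by apply: ray_cts => x /andP[ax xb]; apply: cF; rewrite (le_trans Aa) // (le_trans xb).
    rewrite (@cint_split _ a m b _ am mb); last first.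
      by apply: ray_cts => x /andP[ax xb]; apply: cF; rewrite (le_trans Aa) // (le_trans xb).
    ring.
  - move=> a b c m d Aa ab bB _ cm md _; rewrite /sector_int.
    rewrite /arc_int (@cint_split _ c m d _ cm md); last first.
      by apply: arc_cts => t _; apply: cF; rewrite bB (le_trans Aa).
    rewrite (@cint_split _ c m d _ cm md); last first.
      by apply: arc_cts => t _; apply: cF; rewrite Aa (le_trans ab).
    ring.
  - by move=> x y xAB yCD; exact: sector_int_local xAB yCD.
move: s0; rewrite /sector_int /ray_int.
have -> : (fun x => F (pol x (2 * pi)) * pol 1 (2 * pi)) =
    (fun x => F (pol x 0) * pol 1 0) by apply/funext => x; rewrite !pol_2pi.
by rewrite subrr subr0 => /eqP; rewrite subr_eq0 => /eqP h; exact: esym h.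
Qed.

End Annulus.

(** Shrink the circle to radius 0, where the factor dz / d theta vanishes. *)
Lemma cI_entire_eq0 F r : 0 <= r -> (forall z, derivable F z 1) -> cI r F = 0.
Proof.
move=> r0 dF; rewrite -(@cI_deform F 0 r) // /cI.
rewrite (_ : (fun t => _) = fun=> 0 * 0); last first.
  by apply/funext => t; rewrite pol0 !mulr0.
by rewrite cintZ ?mul0r //; exact: cts_on_cst.
Qed.

End PolarGoursat.

(** * Cauchy estimates *)

Section CauchyEstimates.
Variable R : realType.
Implicit Types (F G h : CC R -> CC R) (z w b : CC R) (r M K : R).
Local Notation I1 := (0 +i* 1 : CC R).

Lemma pi2_gt0 : 0 < 2 * pi :> R.
Proof. by rewrite mulr_gt0 // pi_gt0. Qed.

Lemma circle_cts F r : 0 <= r -> (forall z, cmod z = r -> {for z, continuous F}) ->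
  cts_on 0 (2 * pi) (fun t => F (pol r t) * (I1 * pol r t)).
Proof. by move=> r0 cF; apply: arc_cts => t _; apply: cF; rewrite cmod_pol. Qed.

Lemma eq_cI F G r : 0 <= r -> (forall z, cmod z = r -> F z = G z) -> cI r F = cI r G.
Proof. by move=> r0 FG; apply: eq_cint => t _; rewrite FG ?cmod_pol. Qed.

Lemma cID F G r : 0 <= r -> (forall z, cmod z = r -> {for z, continuous F}) ->
  (forall z, cmod z = r -> {for z, continuous G}) ->
  cI r (fun z => F z + G z) = cI r F + cI r G.
Proof.
move=> r0 cF cG; rewrite /cI -cintD; do ?exact: circle_cts.
by apply: eq_cint => t _; rewrite mulrDl.
Qed.

Lemma cIZ (k : CC R) F r : 0 <= r -> (forall z, cmod z = r -> {for z, continuous F}) ->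
  cI r (fun z => k * F z) = k * cI r F.
Proof.
move=> r0 cF; rewrite /cI -cintZ; do ?exact: circle_cts.
by apply: eq_cint => t _; rewrite -mulrA.
Qed.

Lemma cIB F G r : 0 <= r -> (forall z, cmod z = r -> {for z, continuous F}) ->
  (forall z, cmod z = r -> {for z, continuous G}) ->
  cI r (fun z => F z - G z) = cI r F - cI r G.
Proof.
move=> r0 cF cG; rewrite /cI -cintB; do ?exact: circle_cts.
by apply: eq_cint => t _; rewrite mulrBl.
Qed.

Lemma cI_bound F r M : 0 <= r -> (forall z, cmod z = r -> {for z, continuous F}) ->
  (forall z, cmod z = r -> cmod (F z) <= M) ->
  cmod (cI r F) <= 2 * (M * r) * (2 * pi).
Proof.
move=> r0 cF FM; rewrite -[X in _ * X]subr0; apply: cint_bound.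
- exact: ltW pi2_gt0.
- exact: circle_cts.
- move=> t _; rewrite !cmodM cmod_i mul1r cmod_pol // ler_wpM2r //.
  by rewrite FM // cmod_pol.
Qed.

Lemma is_cderiv_rc (t : R) : is_cderiv (@rc R) t 1.
Proof. by split=> /=; [exact: is_derive_id|exact: is_derive_cst]. Qed.

Lemma cint_cst (k : CC R) (a b : R) : a <= b -> cint a b (fun=> k) = k * rc (b - a).
Proof.
move=> ab; rewrite rcB mulrBr.
apply: (cint_FTC (G := fun t => k * rc t)) => // [t|]; last exact: cts_on_cst.
by have := is_cderivZ k (is_cderiv_rc t); rewrite mulr1.
Qed.

Lemma cI_inv l r : 0 < r -> cI r (fun z => l / z) = l * I1 * rc (2 * pi).
Proof.
move=> r0; rewrite -[X in rc X]subr0 -cint_cst ?(ltW pi2_gt0) //.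
apply: eq_cint => t _; rewrite mulrCA [X in _ * X]mulrAC mulrA.
have p0 : pol r t != 0 by rewrite -cmod_gt0 cmod_pol // ltW.
by field.
Qed.

Lemma derivable_inv_sqr z : z != 0 -> derivable (fun w : CC R => (w ^+ 2)^-1) z 1.
Proof.
move=> z0; apply: derivableV; first by rewrite /= expf_neq0.
by apply: exprn_derivable.
Qed.

(** On a small circle the integrand is l / z up to o(1 / |z|), and the error integrates to something
    arbitrarily small; deformation carries the value to radius r. Removing [h 0] leaves an estimate
    in terms of the oscillation of h. *)
Lemma cauchy_derive h r : 0 < r -> (forall z, derivable h z 1) ->
  cI r (fun z => (h z - h 0) / z ^+ 2) = 'D_1 h 0 * I1 * rc (2 * pi).
Proof.
move=> r0 dh; set l := 'D_1 h 0.
have dF z : z != 0 -> derivable (fun z => (h z - h 0) / z ^+ 2) z 1.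
  move=> z0; apply: derivableM; last exact: derivable_inv_sqr.
  by apply: derivableB.
suff H e : 0 < e -> cmod (cI r (fun z => (h z - h 0) / z ^+ 2) - l * I1 * rc (2 * pi))
    <= e.
  apply/eqP; rewrite -subr_eq0 -cmod_eq0 eq_le cmod_ge0 andbT.
  by apply/ler_addgt0Pr => e /H; rewrite add0r.
(* On the circle of radius rho, [cI_bound] turns an integrand bounded by eta / rho into 4 * pi *
   eta, hence this eta. *)
move=> e0; have e1 : 0 < e / (4 * pi) by rewrite divr_gt0 // mulr_gt0 // pi_gt0.
have [d d0 hd] := derivable_expansion (dh 0) e1.
set rho := Num.min r (d / 2).
have rho0 : 0 < rho by rewrite lt_min r0 divr_gt0.
have rhor : rho <= r by rewrite ge_min lexx.
have rhod : rho < d.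
  rewrite (@le_lt_trans _ _ (d / 2)) ?ge_min ?lexx ?orbT //.
  by rewrite ltr_pdivrMr // ltr_pMr // ltr1n.
have nz z : cmod z = rho -> z != 0 by rewrite -cmod_gt0 => ->.
rewrite -(@cI_deform _ _ rho r (ltW rho0) rhor); last first.
  by move=> z /andP[hz _]; apply: dF; rewrite -cmod_gt0 (lt_le_trans rho0).
rewrite -(cI_inv l rho0) -cIB ?(ltW rho0) //; last 2 first.
- by move=> z /nz z0; exact: derivable_cts (dF z z0).
- move=> z /nz z0; apply: continuousM; first exact: (@cst_continuous _ _ l z).
  exact: inv_continuous.
have pn : (pi : R) != 0 by rewrite lt0r_neq0 // pi_gt0.
have rn : rho != 0 by rewrite lt0r_neq0.
have -> : e = 2 * (e / (4 * pi) / rho * rho) * (2 * pi).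
  by move: pn; move: (pi : R) => p pn; field; rewrite rn pn.
apply: cI_bound; first exact: ltW.
  move=> z /nz z0; apply: continuousB; first exact: derivable_cts (dF z z0).
  apply: continuousM; first exact: (@cst_continuous _ _ l z).
  exact: inv_continuous.
move=> z hz; have z0 := nz z hz.
have -> : (h z - h 0) / z ^+ 2 - l / z = (h z - (h 0 + l * (z - 0))) / z ^+ 2.
  by field.
rewrite cmodM cmodV cmodX hz ler_pdivrMr ?exprn_gt0 //.
have := hd z; rewrite subr0 hz => /(_ rhod) /le_trans; apply.
by rewrite expr2 mulrA divfK // lt0r_neq0.
Qed.

Lemma cauchy_estimate0 h r M : 0 < r -> (forall z, derivable h z 1) ->
  (forall z, cmod z = r -> cmod (h z - h 0) <= M) -> cmod ('D_1 h 0) <= 2 * M / r.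
Proof.
move=> r0 dh hM.
have nz z : cmod z = r -> z != 0 by rewrite -cmod_gt0 => ->.
have : cmod (cI r (fun z => (h z - h 0) / z ^+ 2)) <= 2 * (M / r ^+ 2 * r) * (2 * pi).
  apply: cI_bound; first exact: ltW.
    move=> z /nz z0; apply: continuousM; last exact: derivable_cts (derivable_inv_sqr z0).
    by apply: continuousB; [exact: derivable_cts|exact: (@cst_continuous _ _ (h 0) z)].
  move=> z hz; rewrite cmodM cmodV cmodX hz ler_wpM2r ?invr_ge0 ?exprn_ge0 ?(ltW r0) //.
  exact: hM.
rewrite cauchy_derive // !cmodM cmod_i mulr1 cmod_real ger0_norm ?(ltW pi2_gt0) //.
rewrite ler_pM2r ?pi2_gt0 // => /le_trans; apply.
by rewrite expr2 invfM -!mulrA mulVf ?mulr1 // lt0r_neq0.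
Qed.

Let quotient_comp_shift h w z :
  (fun x => x^-1 *: (((fun y => h (y + w)) \o shift z) (x *: 1) - h (z + w))) =
  (fun x => x^-1 *: ((h \o shift (z + w)) (x *: (1 : CC R)) - h (z + w))).
Proof. by apply/funext => x /=; rewrite addrA. Qed.

Lemma derive_comp_shift h w z : 'D_1 (fun x => h (x + w)) z = 'D_1 h (z + w).
Proof. by rewrite /derive quotient_comp_shift. Qed.

Lemma derivable_comp_shift h w z : derivable h (z + w) 1 ->
  derivable (fun x => h (x + w)) z 1.
Proof. by rewrite /derivable quotient_comp_shift. Qed.

Lemma cauchy_estimate h w r M : 0 < r -> (forall z, derivable h z 1) ->
  (forall z, cmod (z - w) = r -> cmod (h z - h w) <= M) ->
  cmod ('D_1 h w) <= 2 * M / r.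
Proof.
move=> r0 dh hM; rewrite -(add0r w) -derive_comp_shift.
apply: (@cauchy_estimate0 (fun x => h (x + w))) => [//|z|z hz].
  exact: derivable_comp_shift.
by rewrite add0r; apply: hM; rewrite addrK.
Qed.

Lemma is_cderiv_expansion (G : R -> CC R) (t : R) (l : CC R) :
  (forall e : R, 0 < e -> exists2 d : R, 0 < d & forall s, `|s| < d ->
    cmod (G (s + t) - G t - rc s * l) <= e * `|s|) ->
  is_cderiv G t l.
Proof.
move=> H.
(* [p] is the real or the imaginary part: additivity, homogeneity over R and the bound by the
   modulus suffice for both. *)
have key (p : CC R -> R) : (forall z w, p (z - w) = p z - p w) ->
    (forall s z, p (rc s * z) = s * p z) -> (forall z, `|p z| <= cmod z) ->
    is_derive t 1 (fun x => p (G x)) (p l).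
  move=> pB pZ pb.
  suff cl : (h^-1 *: (((fun x => p (G x)) \o shift t) (h *: 1) - p (G t)))
      @[h --> 0^'] --> p l.
    split; first by apply/cvg_ex; exists (p l).
    exact: cvg_lim cl.
  apply/cvgrPdist_le => e e0; have [d d0 hd] := H e e0.
  near=> s.
  have s0 : s != 0 by near: s; exact: nbhs_dnbhs_neq.
  have sd : `|s| < d by near: s; exact: dnbhs0_lt.
  rewrite /= /GRing.scale /= mulr1.
  have -> : p l - s^-1 * (p (G (s + t)) - p (G t)) =
     - (s^-1 * p (G (s + t) - G t - rc s * l)).
    by rewrite !pB pZ; field.
  rewrite normrN normrM normfV mulrC ler_pdivrMr ?normr_gt0 //.
  by rewrite (le_trans (pb _)) // hd.
split; apply: key.
- by move=> [? ?] [? ?].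
- by move=> s [? ?] /=; rewrite mul0r subr0.
- exact: Re_le_cmod.
- by move=> [? ?] [? ?].
- by move=> s [? ?] /=; rewrite mul0r addr0.
- exact: Im_le_cmod.
Unshelve. all: by end_near. Qed.

Lemma is_cderiv_segment h z b (t : R) : (forall w, derivable h w 1) ->
  is_cderiv (fun x => h (z + rc x * b)) t ('D_1 h (z + rc t * b) * b).
Proof.
move=> dh; apply: is_cderiv_expansion => e e0.
set w := z + rc t * b.
have b1 : 0 < cmod b + 1 by rewrite ltr_wpDl // cmod_ge0.
have e1 : 0 < e / (cmod b + 1) by rewrite divr_gt0.
have [d d0 hd] := derivable_expansion (dh w) e1.
exists (d / (cmod b + 1)); first by rewrite divr_gt0.
move=> s; rewrite ltr_pdivlMr // => sd.
have E : z + rc (s + t) * b - w = rc s * b by rewrite /w rcD; ring.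
have sb : cmod (rc s * b) <= `|s| * (cmod b + 1).
  by rewrite cmodM cmod_real ler_wpM2l // lerDl.
have := hd (z + rc (s + t) * b); rewrite E => /(_ (le_lt_trans sb sd)) H.
rewrite (_ : _ - _ - _ = h (z + rc (s + t) * b) - (h w + 'D_1 h w * (rc s * b))).
  rewrite (le_trans H) // (le_trans (ler_wpM2l (ltW e1) sb)) //.
  by rewrite mulrCA divfK ?lt0r_neq0 // mulrC.
by ring.
Qed.

(** The mean value theorem, and not integration of the derivative, because continuity of 'D_1 h has
    not been established. It is applied to the real and imaginary parts in turn, hence the factor
    2. *)
Lemma mean_value_bound h z b l K : (forall w, derivable h w 1) ->
  (forall w, cmod (w - z) <= cmod b -> cmod ('D_1 h w - l) <= K) ->
  cmod (h (z + b) - h z - l * b) <= 2 * (K * cmod b).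
Proof.
move=> dh hK.
pose G (t : R) := h (z + rc t * b) + (- l * b) * rc t.
have dG t : is_cderiv G t (('D_1 h (z + rc t * b) - l) * b).
  apply: is_cderiv_eq; first apply: is_cderivD.
  - exact: is_cderiv_segment.
  - exact: is_cderivZ (is_cderiv_rc t).
  - by ring.
have -> : h (z + b) - h z - l * b = G 1 - G 0.
  by rewrite /G rc0 rc1 mul0r addr0 mul1r; ring.
have Kb t : 0 <= t <= 1 -> cmod (('D_1 h (z + rc t * b) - l) * b) <= K * cmod b.
  move=> /andP[t0 t1]; rewrite cmodM ler_wpM2r ?cmod_ge0 // hK //.
  by rewrite addrC addKr cmodM cmod_real ger0_norm // ler_piMl // cmod_ge0.
have mvt (f df : R -> R) : (forall t : R, is_derive t 1 f (df t)) ->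
    (forall t, 0 <= t <= 1 -> `|df t| <= K * cmod b) -> `|f 1 - f 0| <= K * cmod b.
  move=> df_ fb; have [|c c01 ->] := @MVT_segment R f df 0 1 ler01 (fun t _ => df_ t).
    apply: continuous_subspaceT => t.
    by apply: differentiable_continuous; apply/derivable1_diffP; have [] := df_ t.
  by rewrite subr0 mulr1 fb // -in_itv.
rewrite (le_trans (cmod_le_ReIm _)) // mulr_natl mulr2n lerD //.
- rewrite raddfB; apply: (mvt (fun t => complex.Re (G t))
    (fun t => complex.Re (('D_1 h (z + rc t * b) - l) * b))).
    by move=> t; have [] := dG t.
  by move=> t /Kb; exact: le_trans (Re_le_cmod _).
- rewrite raddfB; apply: (mvt (fun t => complex.Im (G t))
    (fun t => complex.Im (('D_1 h (z + rc t * b) - l) * b))).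
    by move=> t; have [] := dG t.
  by move=> t /Kb; exact: le_trans (Im_le_cmod _).
Qed.

(** * First and second order increments of an entire function bounded on a disc *)

Section Entire.
Variables (h : CC R -> CC R) (r M : R).
Hypotheses (r0 : 0 < r) (dh : forall z, derivable h z 1).
Hypothesis hM : forall z, cmod z <= 3 * r -> cmod (h z) <= M.

(** A circle of radius r about a point of the disc of radius 2r stays in the disc of radius 3r,
    where M bounds h; the oscillation is then at most M + M. *)
Let dh_bound w : cmod w <= 2 * r -> cmod ('D_1 h w) <= 4 * M / r.
Proof.
move=> w2; have M2 : 2 * (M + M) / r = 4 * M / r by congr (_ / r); ring.
rewrite -M2; apply: cauchy_estimate => // z zw.
rewrite (le_trans (cmodB _ _)) // lerD // hM //; last by move: r0 w2; lra.
rewrite -(subrK w z) (le_trans (cmodD _ _)) // zw; move: r0 w2; lra.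
Qed.

Lemma entire_lipschitz z w : cmod z <= r -> cmod w <= r ->
  cmod (h (z + w) - h z) <= 8 * M / r * cmod w.
Proof.
move=> zr wr; have := @mean_value_bound h z w 0 (4 * M / r) dh.
rewrite mul0r subr0 => H; rewrite (le_trans (H _)) //; last first.
  by rewrite !mulrA (_ : 2 * 4 = 8) //; ring.
move=> y yz; rewrite subr0; apply: dh_bound.
rewrite -(subrK z y) (le_trans (cmodD _ _)) //; move: zr wr yz; lra.
Qed.

(** No second derivative is formed. The difference 'D_1 h y - 'D_1 h 0 is the derivative at 0 of the
    increment g z = h (z + y) - h z, which is small by [entire_lipschitz]; Cauchy's estimate for g
    gives 32 M |w| / r^2, and the mean value bound doubles it. *)
Lemma entire_quadratic w : cmod w <= r ->
  cmod (h w - h 0 - 'D_1 h 0 * w) <= 64 * M / r ^+ 2 * cmod w ^+ 2.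
Proof.
move=> wr; have M0 : 0 <= M.
  rewrite (le_trans (cmod_ge0 (h 0))) // hM // cmod0 mulr_ge0 // ltW //.
have := @mean_value_bound h 0 w ('D_1 h 0) (32 * M / r ^+ 2 * cmod w) dh.
rewrite add0r => H; rewrite (le_trans (H _)) //; last first.
  by rewrite le_eqVlt; apply/orP; left; apply/eqP; ring.
move=> y; rewrite subr0 => yw.
have yr := le_trans yw wr.
pose g z := h (z + y) - h z.
have dhy z : derivable (fun x => h (x + y)) z 1 by exact: derivable_comp_shift.
have dg z : derivable g z 1 by apply: derivableB; [exact: dhy|exact: dh].
have -> : 'D_1 h y - 'D_1 h 0 = 'D_1 g 0.
  have E : 'D_1 g 0 = 'D_1 (fun x => h (x + y)) 0 - 'D_1 h 0.
    by apply: deriveB; [exact: dhy|exact: dh].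
  have Ey := derive_comp_shift h y 0; rewrite add0r in Ey.
  exact: esym (etrans E (congr1 (fun u => u - 'D_1 h 0) Ey)).
rewrite (le_trans (@cauchy_estimate0 g r (16 * M / r * cmod w) r0 dg _)) //; last first.
  by rewrite le_eqVlt; apply/orP; left; apply/eqP; field; rewrite lt0r_neq0.
have gb z : cmod z <= r -> cmod (g z) <= 8 * M / r * cmod w.
  move=> zr; rewrite (le_trans (entire_lipschitz zr yr)) // ler_wpM2l //.
  by rewrite divr_ge0 ?mulr_ge0 // ltW.
move=> z zr; rewrite (le_trans (cmodB _ _)) //.
have -> : 16 * M / r * cmod w = 8 * M / r * cmod w + 8 * M / r * cmod w by ring.
by rewrite lerD // gb // ?zr // cmod0 ltW.
Qed.

End Entire.

End CauchyEstimates.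

(** * Symmetry of mixed complex derivatives *)

Section MixedDerivatives.
Variable R : realType.

Section TwoSidedLimit.
Variables (r C : R).
Hypotheses (r0 : 0 < r) (C0 : 0 <= C).

(** The hypothesis says x a - C |a| <= y b + C |b| for all small nonzero a and b, so the supremum of
    the left sides separates the two families. Comparing at b = a puts x a and y a within 3 C |a| of
    it; 5 leaves room. *)
Let two_sided_limit_real (x y : CC R -> R) :
  (forall a b, a != 0 -> b != 0 -> cmod a < r -> cmod b < r ->
    `|x a - y b| <= C * (cmod a + cmod b)) ->
  exists L, forall a, a != 0 -> cmod a < r ->
    `|x a - L| <= 5 * C * cmod a /\ `|y a - L| <= 5 * C * cmod a.
Proof.
move=> H.
pose S := [set x a - C * cmod a | a in [set a | a != 0 /\ cmod a < r]].
have r2 : cmod (rc (r / 2)) < r.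
  by rewrite cmod_real ger0_norm ?divr_ge0 ?(ltW r0) // ltr_pdivrMr // ltr_pMr // ltr1n.
have r20 : rc (r / 2) != 0 by rewrite rc_eq0 lt0r_neq0 // divr_gt0.
have S0 : S !=set0 by exists (x (rc (r / 2)) - C * cmod (rc (r / 2))), (rc (r / 2)).
have Sub a : a != 0 -> cmod a < r -> ubound S (y a + C * cmod a).
  move=> a0 ar _ [a' [a'0 a'r] <-].
  have := H a' a a'0 a0 a'r ar; rewrite ler_norml => /andP[_]; lra.
have hS : has_sup S.
  by split => //; exists (y (rc (r / 2)) + C * cmod (rc (r / 2))); exact: Sub.
exists (sup S) => a a0 ar.
have lo : x a - C * cmod a <= sup S.
  by apply: ub_le_sup; [case: hS|exists a].
have hi : sup S <= y a + C * cmod a by apply: ge_sup => //; exact: Sub.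
have Ca : 0 <= C * cmod a by rewrite mulr_ge0 // cmod_ge0.
have := H a a a0 a0 ar ar; rewrite ler_norml => /andP[h1 h2].
rewrite !ler_norml; split; apply/andP; split; lra.
Qed.

(* The real (imaginary) part of the common limit is the supremum over a of x a - C |a|, with x
   the real (imaginary) part of X; the library has no completeness instance for [CC R]. *)
Lemma two_sided_limit (X Y : CC R -> CC R) :
  (forall a b, a != 0 -> b != 0 -> cmod a < r -> cmod b < r ->
    cmod (X a - Y b) <= C * (cmod a + cmod b)) ->
  exists L : CC R, X @ 0^' --> L /\ Y @ 0^' --> L.
Proof.
move=> H.
have [L1 h1] : exists L, forall a, a != 0 -> cmod a < r ->
    `|complex.Re (X a) - L| <= 5 * C * cmod a /\ `|complex.Re (Y a) - L| <= 5 * C * cmod a.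
  apply: (@two_sided_limit_real (fun a => complex.Re (X a)) (fun a => complex.Re (Y a))).
  move=> a b a0 b0 ar br.
  by rewrite -raddfB (le_trans (Re_le_cmod _)) // H.
have [L2 h2] : exists L, forall a, a != 0 -> cmod a < r ->
    `|complex.Im (X a) - L| <= 5 * C * cmod a /\ `|complex.Im (Y a) - L| <= 5 * C * cmod a.
  apply: (@two_sided_limit_real (fun a => complex.Im (X a)) (fun a => complex.Im (Y a))).
  move=> a b a0 b0 ar br.
  by rewrite -raddfB (le_trans (Im_le_cmod _)) // H.
have key (Z : CC R -> CC R) : (forall a, a != 0 -> cmod a < r ->
    `|complex.Re (Z a) - L1| <= 5 * C * cmod a /\ `|complex.Im (Z a) - L2| <= 5 * C * cmod a) ->
    Z @ 0^' --> (L1 +i* L2 : CC R).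
  move=> hZ; apply/cvg_cmodP => e e0; apply/nbhs0_cmodP.
  have d0 : 0 < 10 * C + 1 by rewrite ltr_wpDl // mulr_ge0.
  exists (Num.min r (e / (10 * C + 1))); first by rewrite lt_min r0 divr_gt0.
  move=> a a0; rewrite lt_min ltr_pdivlMr // => /andP[ar ae].
  have [hr hi] := hZ a a0 ar.
  rewrite (le_lt_trans (cmod_le_ReIm _)) // !raddfB /=.
  rewrite (le_lt_trans (lerD hr hi)) // (le_lt_trans _ ae) //.
  by have := cmod_ge0 a; lra.
by exists (L1 +i* L2); split; apply: key => a a0 ar; have [? ?] := h1 a a0 ar;
  have [? ?] := h2 a a0 ar.
Qed.

End TwoSidedLimit.

(** * Second differences of a separately holomorphic function of two variables *)

Section TwoVariables.
Variables (g : CC R -> CC R -> CC R) (r M : R).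
Hypotheses (r0 : 0 < r).
Hypothesis dg1 : forall b a, derivable (g^~ b) a 1.
Hypothesis dg2 : forall a b, derivable (g a) b 1.
Hypothesis gM : forall a b, cmod a <= 3 * r -> cmod b <= 3 * r -> cmod (g a b) <= M.

(** The constant of [entire_quadratic], with its bound M replaced by the Lipschitz constant 8 M / r
    of [entire_lipschitz]. *)
Let C := 64 * (8 * M / r) / r ^+ 2.

Let C_ge0 : 0 <= C.
Proof.
have M0 : 0 <= M by rewrite (le_trans (cmod_ge0 (g 0 0))) // gM // cmod0 mulr_ge0 // ltW.
by rewrite /C !(mulr_ge0, invr_ge0, exprn_ge0) // ltW.
Qed.

Let quotient_identity (p q x y a b u v : CC R) : a != 0 -> b != 0 ->
  (p - q - (x - y)) / (a * b) - a^-1 * (u - v) =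
  (p - q - (x - y) - (u - v) * b) / (a * b).
Proof. by move=> a0 b0; field; rewrite a0 b0. Qed.

(** The increment H = f a - f 0 is O(|a|) on a whole disc, so its quadratic remainder in b is O(|a|
    |b|^2), and division by a b leaves O(|b|) uniformly in a. The function f is a parameter so that
    the variables can be exchanged. *)
Let second_difference (f : CC R -> CC R -> CC R) a b :
  (forall b a, derivable (f^~ b) a 1) -> (forall a b, derivable (f a) b 1) ->
  (forall a b, cmod a <= 3 * r -> cmod b <= 3 * r -> cmod (f a b) <= M) ->
  a != 0 -> b != 0 -> cmod a < r -> cmod b < r ->
  cmod ((f a b - f 0 b - (f a 0 - f 0 0)) / (a * b)
        - a^-1 * ('D_1 (f a) 0 - 'D_1 (f 0) 0)) <= C * cmod b.
Proof.
move=> df1 df2 fM a0 b0 ar br.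
pose H z := f a z - f 0 z.
have dH z : derivable H z 1 by apply: derivableB; exact: df2.
have HM z : cmod z <= 3 * r -> cmod (H z) <= 8 * M / r * cmod a.
  move=> zr; have := @entire_lipschitz R (f^~ z) r M r0 (df1 z) (fun y hy => fM y z hy zr) 0 a.
  by rewrite add0r cmod0; apply; rewrite ltW.
have dH0 : 'D_1 H 0 = 'D_1 (f a) 0 - 'D_1 (f 0) 0.
  by apply: deriveB; exact: df2.
have := @entire_quadratic R H r _ r0 dH HM b (ltW br); rewrite dH0 => Hq.
rewrite quotient_identity //.
rewrite cmodM cmodV cmodM ler_pdivrMr ?mulr_gt0 ?cmod_gt0 //.
rewrite (le_trans Hq) // le_eqVlt; apply/orP; left; apply/eqP.
by rewrite /C; field; rewrite lt0r_neq0.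
Qed.

(* At (a, b), both quotients differ by O(|a| + |b|) from the second difference
   (g a b - g 0 b - g a 0 + g 0 0) / (a b). *)
Lemma mixed_quotients_cvg (g' : CC R -> CC R -> CC R) :
  (forall b, g^~ b = g' b) -> exists L : CC R,
  (fun a => a^-1 * ('D_1 (g a) 0 - 'D_1 (g 0) 0)) @ 0^' --> L /\
  (fun b => b^-1 * ('D_1 (g' b) 0 - 'D_1 (g' 0) 0)) @ 0^' --> L.
Proof.
move=> gg'; have -> : g' = fun b a => g a b by apply/funext => b; rewrite -gg'.
apply: (@two_sided_limit r C r0 C_ge0) => a b a0 b0 ar br.
have h1 := second_difference dg1 dg2 gM a0 b0 ar br.
have h2 := @second_difference (fun x y => g y x) b a dg2 dg1
  (fun x y hx hy => gM hy hx) b0 a0 br ar.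
set X := a^-1 * _ in h1 *; set Y := b^-1 * _ in h2 *.
set D := _ / (a * b) in h1.
have DE : (g a b - g a 0 - (g 0 b - g 0 0)) / (b * a) = D.
  by rewrite /D (mulrC b); congr (_ / _); ring.
rewrite DE in h2.
have T (p q t : CC R) : cmod (p - q) <= cmod (t - q) + cmod (t - p).
  by rewrite (_ : p - q = (t - q) - (t - p)) ?cmodB //; ring.
by apply: (le_trans (T X Y D)); rewrite mulrDr; exact: lerD h2 h1.
Qed.

End TwoVariables.

Section Schwarz.
Variable V : normedModType (CC R).
Implicit Types (F : V -> CC R) (u v s : V).

Let line_quotient F v (w : V) (b : CC R) :
  (fun x => x^-1 *: (((fun b : CC R => F (b *: v + w)) \o shift b) (x *: (1 : CC R)) - F (b *: v + w))) =
  (fun x => x^-1 *: ((F \o shift (b *: v + w)) (x *: v) - F (b *: v + w))).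
Proof.
by apply/funext => x /=; rewrite addrA -scalerDl /GRing.scale /= mulr1.
Qed.

Lemma derive_line F v (w : V) (b : CC R) :
  'D_1 (fun b : CC R => F (b *: v + w)) b = 'D_v F (b *: v + w).
Proof. by rewrite /derive line_quotient. Qed.

Lemma derivable_line F v (w : V) (b : CC R) : derivable F (b *: v + w) v ->
  derivable (fun b : CC R => F (b *: v + w)) b 1.
Proof. by rewrite /derivable line_quotient. Qed.

(** Real-valued version of the norm, which on a normed module over [CC R] takes its values in
    [CC R]. *)
Definition vnorm v : R := cmod `|v|.

Lemma vnormE v : `|v| = rc (vnorm v).
Proof. by rewrite /vnorm -normCE normr_id. Qed.

Lemma vnorm_ge0 v : 0 <= vnorm v.
Proof. exact: cmod_ge0. Qed.

Lemma vnormD u v : vnorm (u + v) <= vnorm u + vnorm v.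
Proof. by rewrite -ler_rc rcD -!vnormE ler_normD. Qed.

Lemma vnormZ a v : vnorm (a *: v) = cmod a * vnorm v.
Proof. by apply: rc_inj; rewrite rcM -!vnormE -normCE normrZ. Qed.

Lemma nbhs_vnormP s (P : set V) :
  nbhs s P <-> exists2 d : R, 0 < d & forall w, vnorm w < d -> P (w + s).
Proof.
split.
  move=> /nbhs_normP[e /= e0 eP].
  have er : e = rc (complex.Re e).
    by case: e e0 {eP} => a b; rewrite ltcE /= => /andP[/eqP -> _].
  exists (complex.Re e); first by rewrite -ltr_rc -er.
  move=> w wz; apply: eP; rewrite /ball_ /= opprD addrCA subrr addr0 normrN.
  by rewrite vnormE er ltr_rc.
move=> [d d0 dP]; apply/nbhs_normP; exists (rc d); first by rewrite /= ltr_rc.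
move=> w; rewrite /ball_ /= distrC vnormE ltr_rc => wz.
by rewrite -(subrK s w); apply: dP.
Qed.

(** The slice (a, b) -> F (s + a u + b v) is entire in each variable and bounded near 0 by
    continuity of F at s. The existence of the mixed derivative is part of the conclusion. *)
Lemma derive_sym_scalar F u v s : (forall x, differentiable F x) ->
  derivable ('D_v F) s u /\ 'D_u ('D_v F) s = 'D_v ('D_u F) s.
Proof.
move=> dF.
have : \forall x \near s, cmod (F x - F s) < 1.
  have /cvg_cmodP := differentiable_continuous (dF s).
  by apply.
move=> /nbhs_vnormP[d d0 hd].
pose N := vnorm u + vnorm v + 1.
have N0 : 0 < N by rewrite ltr_wpDl // addr_ge0 // vnorm_ge0.
(* For |a|, |b| <= 3 r the displacement a u + b v has norm at most 3 r N < d; the +1 in N makes it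
   positive even when u = v = 0. *)
pose r := d / (4 * N); have r0 : 0 < r by rewrite divr_gt0 // mulr_gt0.
pose g (a b : CC R) := F (b *: v + (a *: u + s)).
pose g' (b a : CC R) := F (a *: u + (b *: v + s)).
have gE b : g^~ b = g' b by apply/funext => a; rewrite /g addrCA.
have dg1 b a : derivable (g^~ b) a 1.
  by rewrite gE; apply: derivable_line; exact: diff_derivable.
have dg2 a b : derivable (g a) b 1.
  by apply: derivable_line; exact: diff_derivable.
have gM a b : cmod a <= 3 * r -> cmod b <= 3 * r -> cmod (g a b) <= cmod (F s) + 1.
  move=> ar br; rewrite /g addrA -[F _](subrK (F s)).
  rewrite (le_trans (cmodD _ _)) // [leRHS]addrC lerD // ltW // hd //.
  rewrite (le_lt_trans (vnormD _ _)) // !vnormZ.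
  have dE : d = r * (4 * N) by rewrite /r divfK // lt0r_neq0 // mulr_gt0.
  have h1 : cmod b * vnorm v <= 3 * r * vnorm v by rewrite ler_wpM2r ?vnorm_ge0.
  have h2 : cmod a * vnorm u <= 3 * r * vnorm u by rewrite ler_wpM2r ?vnorm_ge0.
  rewrite (le_lt_trans (lerD h1 h2)) //.
  rewrite (@le_lt_trans _ _ (r * (3 * N))) //.
    have -> : r * (3 * N) = 3 * r * vnorm v + 3 * r * vnorm u + 3 * r by rewrite /N; ring.
    by rewrite lerDl mulr_ge0 // ltW.
  by rewrite dE ltr_pM2l // ltr_pM2r // ltr_nat.
have [L [hX hY]] := mixed_quotients_cvg r0 dg1 dg2 gM gE.
have gX a : 'D_v F (a *: u + s) = 'D_1 (g a) 0.
  have e := derive_line F v (a *: u + s) 0; rewrite scale0r add0r in e; exact: esym e.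
have gX0 := gX 0; rewrite scale0r add0r in gX0.
have gY b : 'D_u F (b *: v + s) = 'D_1 (g' b) 0.
  have e := derive_line F u (b *: v + s) 0; rewrite scale0r add0r in e; exact: esym e.
have gY0 := gY 0; rewrite scale0r add0r in gY0.
have X : (fun a => a^-1 *: (('D_v F \o shift s) (a *: u) - 'D_v F s)) @ 0^' --> L.
  have E : (fun a => a^-1 *: (('D_v F \o shift s) (a *: u) - 'D_v F s)) =
      (fun a => a^-1 * ('D_1 (g a) 0 - 'D_1 (g 0) 0)).
    apply/funext => a; have K := congr2 (fun p q => a^-1 * (p - q)) (gX a) gX0.
    by refine (etrans _ K); reflexivity.
  by rewrite E; exact: hX.
have Y : (fun a => a^-1 *: (('D_u F \o shift s) (a *: v) - 'D_u F s)) @ 0^' --> L.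
  have E : (fun a => a^-1 *: (('D_u F \o shift s) (a *: v) - 'D_u F s)) =
      (fun a => a^-1 * ('D_1 (g' a) 0 - 'D_1 (g' 0) 0)).
    apply/funext => a; have K := congr2 (fun p q => a^-1 * (p - q)) (gY a) gY0.
    by refine (etrans _ K); reflexivity.
  by rewrite E; exact: hY.
clear gX gX0 gY gY0 hX hY; split; first by apply/cvg_ex; exists L; exact: X.
have lX : 'D_u ('D_v F) s = L by apply: cvg_lim; [exact: norm_hausdorff|exact: X].
have lY : 'D_v ('D_u F) s = L by apply: cvg_lim; [exact: norm_hausdorff|exact: Y].
exact: etrans lX (esym lY).
Qed.

End Schwarz.

End MixedDerivatives.

(** * Column-valued functions, treated entry by entry *)

Section VectorCalculus.
Variable R : realType.

Lemma cvg_mx (T : Type) (F : set_system T) (FF : Filter F) (m n : nat)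
    (f : T -> 'M[CC R]_(m, n)) (l : 'M[CC R]_(m, n)) :
  (forall i j, (fun x => f x i j) @ F --> l i j) -> f @ F --> l.
Proof.
move=> fl A [P nP PA].
have H : \forall x \near F, forall i : 'I_m, forall j : 'I_n, P i j (f x i j).
  apply: filter_forall => i; apply: filter_forall => j; exact: (fl i j _ (nP i j)).
apply: (@filterS _ F FF [set x | forall i j, P i j (f x i j)] (f @^-1` A) _ H).
by move=> x Px; apply: PA => i j; exact: (Px i j).
Qed.

Variable V : normedModType (CC R).

Lemma derivable_derive_col (k : nat) (F : V -> 'cV[CC R]_k) x v :
  (forall i, derivable (fun y => F y i 0) x v) ->
  derivable F x v /\ 'D_v F x = \col_i 'D_v (fun y => F y i 0) x.
Proof.
move=> dF.
have H : (fun h => h^-1 *: ((F \o shift x) (h *: v) - F x)) @ 0^' -->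
    (\col_i 'D_v (fun y => F y i 0) x : 'cV[CC R]_k).
  apply: cvg_mx => i j; rewrite (ord1 j) mxE.
  have -> : (fun h => (h^-1 *: ((F \o shift x) (h *: v) - F x)) i 0) =
      (fun h => h^-1 *: (((fun y => F y i 0) \o shift x) (h *: v) - F x i 0)).
    by apply/funext => h; rewrite !mxE.
  exact: dF.
split; first by apply/cvg_ex; eexists; exact: H.
by apply: cvg_lim; [exact: norm_hausdorff|exact: H].
Qed.

Lemma derivable_entry (k : nat) (F : V -> 'cV[CC R]_k) x v i :
  derivable F x v -> derivable (fun y => F y i 0) x v.
Proof.
move=> dF; have H : (fun h => h^-1 *: (((fun y => F y i 0) \o shift x) (h *: v) - F x i 0))
    @ 0^' --> ('D_v F x) i 0.
  have -> : (fun h => h^-1 *: (((fun y => F y i 0) \o shift x) (h *: v) - F x i 0)) =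
      (fun h => (h^-1 *: ((F \o shift x) (h *: v) - F x)) i 0).
    by apply/funext => h; rewrite !mxE.
  exact: (cvg_comp _ _ dF (@coord_continuous _ _ _ i 0 ('D_v F x))).
by apply/cvg_ex; eexists; exact: H.
Qed.

Lemma derive_entry (k : nat) (F : V -> 'cV[CC R]_k) x v i :
  derivable F x v -> ('D_v F x) i 0 = 'D_v (fun y => F y i 0) x.
Proof.
move=> dF; have [_ ->] := derivable_derive_col (fun j => @derivable_entry k F x v j dF).
by rewrite mxE.
Qed.

Lemma differentiable_col (k : nat) (F : V -> 'cV[CC R]_k) x :
  (forall i, differentiable (fun y => F y i 0 : CC R) x) -> differentiable F x.
Proof.
move=> dF.
have -> : F = \sum_(i < k) (fun y => F y i 0 *: (delta_mx i 0 : 'cV[CC R]_k)).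
  apply/funext => y; rewrite fct_sumE {1}[F y]matrix_sum_delta.
  by apply: eq_bigr => i _; rewrite big_ord1.
by apply: differentiable_sum => i; apply: differentiableZl; exact: dF.
Qed.

Lemma differentiable_entry (k : nat) (F : V -> 'cV[CC R]_k) x i :
  differentiable F x -> differentiable (fun y => F y i 0 : CC R) x.
Proof.
move=> dF; exact: (differentiable_comp dF (differentiable_coord (F x) i 0)).
Qed.

Lemma derive_sym (k : nat) (F : V -> 'cV[CC R]_k) (u v s : V) :
  (forall x, differentiable F x) ->
  derivable ('D_v F) s u /\ 'D_u ('D_v F) s = 'D_v ('D_u F) s.
Proof.
move=> dF.
have dFw w i : (fun y => ('D_w F y) i 0) = 'D_w (fun y => F y i 0).
  by apply/funext => y; rewrite derive_entry //; exact: diff_derivable.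
have sc i w w' := @derive_sym_scalar R V (fun y => F y i 0) w w' s
  (fun x => @differentiable_entry k F x i (dF x)).
have dw w w' i : derivable (fun y => ('D_w F y) i 0) s w'.
  by rewrite dFw; have [] := sc i w' w.
have [d1 e1] := derivable_derive_col (dw v u).
have [d2 e2] := derivable_derive_col (dw u v).
split; first exact: d1.
have E : (fun i => 'D_u (fun y => ('D_v F y) i 0) s) =
    (fun i => 'D_v (fun y => ('D_u F y) i 0) s).
  apply/funext => i; have [_ e] := sc i u v.
  refine (etrans (congr1 (fun f : V -> CC R => 'D_u f s) (dFw v i)) (etrans e _)).
  exact (congr1 (fun f : V -> CC R => 'D_v f s) (esym (dFw u i))).
refine (etrans e1 (etrans _ (esym e2))).
exact (congr1 (fun g : 'I_k -> CC R => \col_i g i) E).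
Qed.

End VectorCalculus.

(** * Differentiability from a quadratic remainder *)

Section QuadraticRemainder.
Variables (R : realType) (k : nat).
Implicit Types (s v : 'rV[CC R]_k) (d : 'I_k -> CC R).

Lemma cmod_coord_le v (h : 'I_k) : cmod (v 0 h) <= vnorm v.
Proof.
rewrite -ler_rc -vnormE -normCE; have : `|v 0 h| <= mx_norm v; last by [].
rewrite mx_normE -[leLHS]nngE num_le.
exact: (le_bigmax _ (fun i => `|v i.1 i.2|%:nng) (0, h)).
Qed.

(** The d h are candidate partial derivatives. A remainder O(|v|^2) is o(|v|), so the linear form
    they define is the differential by uniqueness. *)
Lemma differentiable_quadratic (G : 'rV[CC R]_k -> CC R) s d (del K : R) :
  0 < del ->
  (forall v, vnorm v < del ->
     cmod (G (v + s) - G s - \sum_h v 0 h * d h) <= K * vnorm v ^+ 2) ->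
  differentiable G s /\ forall v, 'D_v G s = \sum_h v 0 h * d h.
Proof.
move=> del0 HG; pose D v : CC R := \sum_h v 0 h * d h.
have Dlin : linear D.
  move=> a u v; rewrite /D scaler_sumr -big_split /=; apply: eq_bigr => h _.
  by rewrite !mxE mulrDl /GRing.scale /= mulrA.
have Dcts : continuous D.
  move=> v; apply: differentiable_continuous.
  have -> : D = \sum_h (fun v => v 0 h * d h) by apply/funext => w; rewrite fct_sumE.
  apply: differentiable_sum => h; apply: differentiableM.
    exact: differentiable_coord.
  exact: differentiable_cst.
pose DM := GRing.isLinear.Build _ _ _ _ _ Dlin.
pose DL : {linear _ -> _} := HB.pack D DM.
have exp : G \o shift s = cst (G s) + (DL : 'rV[CC R]_k -> CC R) +o_ (0 : 'rV[CC R]_k) id.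
  apply/eqaddoP => e e0.
  have er : e = rc (complex.Re e).
    by case: e e0 => a b; rewrite ltcE /= => /andP[/eqP -> _].
  have e1 : 0 < complex.Re e by rewrite -ltr_rc -er.
  have K1 : 0 < `|K| + 1 by rewrite ltr_wpDl.
  apply/nbhs_vnormP; exists (Num.min del (complex.Re e / (`|K| + 1))).
    by rewrite lt_min del0 divr_gt0.
  move=> v; rewrite lt_min ltr_pdivlMr // => /andP[v1 v2].
  rewrite addr0 normCE vnormE er -rcM ler_rc.
  have := HG v v1; rewrite -/(D v) => H.
  rewrite (_ : (_ - _) v = G (v + s) - G s - D v); last first.
    by rewrite !fctE /= opprD addrA.
  rewrite (le_trans H) // expr2 mulrA ler_wpM2r ?vnorm_ge0 //.
  rewrite (le_trans _ (ltW v2)) // mulrC ler_wpM2l ?vnorm_ge0 //.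
  by rewrite (le_trans (ler_norm _)) // lerDl.
have dE : 'd G s = DL :> ('rV[CC R]_k -> CC R) by exact: diff_unique.
have dG : differentiable G s by apply/diff_locallyP; rewrite dE.
by split=> // v; rewrite deriveE // dE.
Qed.

End QuadraticRemainder.

(** * Holomorphy of the contour integral *)

Section ContourRepresentation.
Variables (R : realType) (k : nat).
Hypothesis k0 : (0 < k)%N.
Implicit Types (s v : 'rV[CC R]_k) (z : CC R) (f : CC R -> CC R) (r : R).
Local Notation rad := (@Defs.rad R k).
Local Notation c0 := ((0 +i* (2 * pi))^-1 : CC R).

Lemma scoefS s (h : 'I_k) : scoef s h.+1 = s 0 h.
Proof. by rewrite /scoef valK. Qed.

Definition Ls s z : CC R := \sum_(h < k) (-1) ^+ h.+1 * s 0 h * z ^+ (k - h.+1).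

Lemma PsE s z : Ps s z = z ^+ k + Ls s z.
Proof.
rewrite /Ps big_ord_recl expr0 !mul1r subn0; congr (_ + _).
by apply: eq_bigr => h _; rewrite lift0 scoefS.
Qed.

Lemma PsD v s z : Ps (v + s) z = Ps s z + Ls v z.
Proof.
rewrite !PsE -addrA; congr (_ + _); rewrite /Ls -big_split /=.
by apply: eq_bigr => h _; rewrite mxE mulrDr mulrDl addrC.
Qed.

Lemma cmod_Ls s z : 1 <= cmod z ->
  cmod (Ls s z) <= (\sum_(h < k) cmod (s 0 h)) * cmod z ^+ k.-1.
Proof.
move=> z1; rewrite (le_trans (cmod_sum _ _ _)) // mulr_suml ler_sum // => h _.
rewrite !cmodM cmod_sign mul1r cmodX ler_wpM2l ?cmod_ge0 // ler_weXn2l //.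
by rewrite subnS -!subn1 leq_sub2r // leq_subr.
Qed.

Lemma rad_ge1 s : 1 <= rad s.
Proof. by rewrite /Defs.rad lerDl sumr_ge0 // => h _; exact: cmod_ge0. Qed.

(** With S the sum of the |s_h|, |P_s(z)| >= |z|^(k-1) (|z| - S), and |z| >= 1 + S >= 1. A uniform
    lower bound, stronger than nonvanishing, controls the denominators of the remainder below. *)
Lemma cmod_Ps_ge1 s z : rad s <= cmod z -> 1 <= cmod (Ps s z).
Proof.
move=> hz; have z1 : 1 <= cmod z := le_trans (rad_ge1 s) hz.
have zk : 1 <= cmod z ^+ k.-1 by rewrite exprn_ege1.
have : cmod (z ^+ k) <= cmod (Ps s z) + cmod (Ls s z).
  by rewrite -{1}(addrK (Ls s z) (z ^+ k)) -PsE cmodB.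
rewrite cmodX -{1}(prednK k0) exprS => H.
have := cmod_Ls s z1; move: hz; rewrite /Defs.rad.
set S := \sum_h _; set t := _ ^+ _ in zk H *; move=> hz hL.
have : (1 + S) * t <= cmod z * t by rewrite ler_wpM2r // (le_trans ler01).
rewrite mulrDl mul1r; lra.
Qed.

Lemma Ps_neq0 s z : rad s <= cmod z -> Ps s z != 0.
Proof. by move=> /cmod_Ps_ge1 h; rewrite -cmod_gt0 (lt_le_trans ltr01). Qed.

Lemma derivable_Ps s z : derivable (Ps s) z 1.
Proof.
have -> : Ps s = \sum_(h < k.+1) (fun z => (-1) ^+ h * scoef s h * z ^+ (k - h)).
  by apply/funext => w; rewrite fct_sumE.
apply: derivable_sum => h; apply: derivableM; first exact: derivable_cst.
exact: exprn_derivable.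
Qed.

Lemma derivable_kernel f s i z : derivable f z 1 -> rad s <= cmod z ->
  derivable (fun w => f w * w ^+ i / Ps s w) z 1.
Proof.
move=> df hz; apply: derivableM.
  by apply: derivableM; [exact: df|exact: exprn_derivable].
by apply: derivableV; [exact: Ps_neq0|exact: derivable_Ps].
Qed.

(** All roots lie inside the circle of radius [rad s], so deformation outwards gives one radius
    common to all nearby parameters. *)
Lemma PhiF_entry f s i r : (forall z, derivable f z 1) -> rad s <= r ->
  PhiF f s i 0 = c0 * cI r (fun z => f z * z ^+ i / Ps s z).
Proof.
move=> df sr; have s0 : 0 <= rad s := le_trans ler01 (rad_ge1 s).
rewrite -(@cI_deform _ _ (rad s) r s0 sr); last first.
  by move=> z /andP[hz _]; exact: derivable_kernel.
rewrite /PhiF !mxE; congr (_ * _).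
apply: eq_cint => t _; cbv beta zeta; rewrite !mxE; congr (_ * _).
by rewrite mulrAC.
Qed.

Lemma cI_sum n (a : 'I_n -> CC R) (F : 'I_n -> CC R -> CC R) r : 0 <= r ->
  (forall h z, cmod z = r -> {for z, continuous (F h)}) ->
  cI r (fun z => \sum_h a h * F h z) = \sum_h a h * cI r (F h).
Proof.
move=> r0 cF.
have caF h z : cmod z = r -> {for z, continuous (fun z => a h * F h z)}.
  move=> zr; apply: continuousM; last exact: cF.
  exact: (@cst_continuous _ _ (a h) z).
have cS (l : seq 'I_n) z : cmod z = r ->
    {for z, continuous (fun z => \sum_(h <- l) a h * F h z)}.
  move=> zr; elim: l => [|h l IH].
    have -> : (fun z => \sum_(h <- [::]) a h * F h z) = fun=> 0.
      by apply/funext => w; rewrite big_nil.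
    exact: (@cst_continuous _ _ 0 z).
  have -> : (fun z => \sum_(j <- h :: l) a j * F j z) =
      fun z => a h * F h z + \sum_(j <- l) a j * F j z.
    by apply/funext => w; rewrite big_cons.
  by apply: continuousD; [exact: caF|exact: IH].
elim: (index_enum _) => [|h l IH].
  rewrite big_nil; apply: etrans (mul0r (cI r (fun=> 0))); rewrite -cIZ //; last first.
    by move=> z _; exact: (@cst_continuous _ _ 0 z).
  by apply: eq_cI => // z _; rewrite big_nil mul0r.
rewrite big_cons -IH -cIZ //; last exact: cF.
rewrite -cID //; [|exact: caF|exact: cS].
by apply: eq_cI => // z _; rewrite big_cons.
Qed.

Lemma circle_max f r : 0 <= r -> (forall z, {for z, continuous f}) ->
  exists2 M, 0 <= M & forall t, 0 <= t <= 2 * pi -> cmod (f (pol r t)) <= M.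
Proof.
move=> r0 cf; pose g t := cmod (f (pol r t)).
have cg t : {for t, continuous g}.
  have -> : g = (fun z : CC R => complex.Re `|z|) \o (f \o pol r).
    by apply/funext => u; exact: (esym (congr1 (@complex.Re R) (normCE (f (pol r u))))).
  apply: continuous_comp.
    by apply: continuous_comp; [exact: cts_pol_angle|exact: cf].
  apply: continuous_comp; first exact: norm_continuous.
  exact: continuous_ReC.
have [|c _ hc] := @EVT_max R g 0 (2 * pi) (ltW (pi2_gt0 R)).
  by apply: continuous_in_subspaceT => t _; exact: cg.
exists (g c); first exact: cmod_ge0.
by move=> t ht; apply: hc; rewrite in_itv.
Qed.

(** Candidate for the partial derivative of entry i in s_(h+1), obtained by differentiating under
    the integral sign. The radius [rad s + 1] leaves room for perturbing s. *)
Definition dPhi f s (i h : nat) : CC R :=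
  - (c0 * ((-1) ^+ h.+1 * cI (rad s + 1)
      (fun z => f z * z ^+ i * z ^+ (k - h.+1) / Ps s z ^+ 2))).

Let remainder_identity (u P L : CC R) : P != 0 -> P + L != 0 ->
  u / (P + L) - u / P + u * L / P ^+ 2 = u * L ^+ 2 / (P ^+ 2 * (P + L)).
Proof. by move=> P0 PL0; field; rewrite P0 PL0. Qed.

Lemma rad_addl v s : rad (v + s) <= rad s + k%:R * vnorm v.
Proof.
rewrite /Defs.rad -addrA lerD2l.
have -> : k%:R * vnorm v = \sum_(h < k) vnorm v.
  by rewrite sumr_const card_ord mulr_natl.
rewrite -big_split /= ler_sum // => h _.
by rewrite mxE (le_trans (cmodD _ _)) // [leRHS]addrC lerD2r cmod_coord_le.
Qed.

Lemma PhiF_quadratic f s (i : 'I_k) : (forall z, derivable f z 1) ->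
  exists2 del : R, 0 < del & exists K, forall v, vnorm v < del ->
    cmod (PhiF f (v + s) i 0 - PhiF f s i 0 - \sum_(h < k) v 0 h * dPhi f s i h)
      <= K * vnorm v ^+ 2.
Proof.
move=> df; pose r := rad s + 1.
have sr : rad s <= r by rewrite lerDl.
have r1 : 1 <= r := le_trans (rad_ge1 s) sr.
have r0 : 0 <= r := le_trans ler01 r1.
have k1 : 0 < k%:R + 1 :> R by rewrite ltr_wpDl.
(* By [rad_addl], this makes [rad (v + s)] at most [rad s + 1], so the circle of radius r serves s
   and v + s alike. *)
exists (k%:R + 1)^-1; first by rewrite invr_gt0.
pose u z := f z * z ^+ i.
have cu z : {for z, continuous u}.
  by apply: derivable_cts; apply: derivableM; [exact: df|exact: exprn_derivable].
have [M M0 uM] := circle_max r0 cu.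
have cP z : {for z, continuous (Ps s)} by apply: derivable_cts; exact: derivable_Ps.
(* On the circle |L_v| <= B |v|, since each of the k coordinates of v is at most |v| and each power
   of z at most r^(k-1). *)
pose B := k%:R * r ^+ k.-1.
exists (cmod c0 * (2 * (M * B ^+ 2 * r) * (2 * pi))) => v vd.
have vr : rad (v + s) <= r.
  rewrite (le_trans (rad_addl _ _)) // lerD2l.
  have : (k%:R + 1) * vnorm v <= 1.
    by rewrite mulrC -ler_pdivlMr // mul1r ltW.
  by apply: le_trans; rewrite mulrDl mul1r lerDl vnorm_ge0.
have Pn z : cmod z = r -> Ps s z != 0 by move=> zr; apply: Ps_neq0; rewrite zr.
have P'n z : cmod z = r -> Ps (v + s) z != 0 by move=> zr; apply: Ps_neq0; rewrite zr.
have cX (m : nat) z : {for z, continuous (fun w : CC R => w ^+ m)}.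
  by apply: derivable_cts; exact: exprn_derivable.
have cP2 z : cmod z = r -> {for z, continuous (fun w => (Ps s w ^+ 2)^-1)}.
  move=> zr; apply: continuousV; first by rewrite expf_neq0 // Pn.
  apply: (@continuous_comp _ _ _ (Ps s) (fun w : CC R => w ^+ 2)); first exact: cP.
  exact: cX.
have ck z : cmod z = r -> {for z, continuous (fun w => u w / Ps s w)}.
  by move=> zr; apply: derivable_cts; apply: derivable_kernel; rewrite ?zr.
have ck' z : cmod z = r -> {for z, continuous (fun w => u w / Ps (v + s) w)}.
  by move=> zr; apply: derivable_cts; apply: derivable_kernel; rewrite ?zr.
have cW (h : 'I_k) z : cmod z = r ->
    {for z, continuous (fun w => u w * w ^+ (k - h.+1) / Ps s w ^+ 2)}.
  move=> zr; apply: continuousM; last exact: cP2.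
  by apply: continuousM; [exact: cu|exact: cX].
pose W z := u z * Ls v z / Ps s z ^+ 2.
have WE : W = fun z => \sum_(h < k) ((-1) ^+ h.+1 * v 0 h) *
    (u z * z ^+ (k - h.+1) / Ps s z ^+ 2).
  apply/funext => z; rewrite /W /Ls mulr_sumr mulr_suml; apply: eq_bigr => h _.
  by rewrite mulrCA !mulrA.
have cWW z : cmod z = r -> {for z, continuous W}.
  move=> zr; apply: continuousM; last exact: cP2.
  apply: continuousM; first exact: cu.
  have -> : Ls v = fun w => Ps v w - w ^+ k.
    by apply/funext => w; rewrite PsE addrC addKr.
  apply: continuousB; last exact: cX.
  by apply: derivable_cts; exact: derivable_Ps.
have sumE : \sum_(h < k) v 0 h * dPhi f s i h = - (c0 * cI r W).
  rewrite WE cI_sum // mulr_sumr -sumrN; apply: eq_bigr => h _.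
  by rewrite /dPhi -/r mulrN mulrCA; congr (- (_ * _)); rewrite mulrCA mulrA.
pose T z := u z / Ps (v + s) z - u z / Ps s z + W z.
have TE z : cmod z = r -> T z = u z * Ls v z ^+ 2 / (Ps s z ^+ 2 * Ps (v + s) z).
  move=> zr; rewrite /T /W PsD; apply: remainder_identity; first exact: Pn.
  by rewrite -PsD P'n.
have cT z : cmod z = r -> {for z, continuous T}.
  move=> zr; apply: continuousD; last exact: cWW.
  by apply: continuousB; [exact: ck'|exact: ck].
have -> : PhiF f (v + s) i 0 - PhiF f s i 0 - \sum_(h < k) v 0 h * dPhi f s i h =
    c0 * cI r T.
  rewrite sumE opprK (PhiF_entry i df vr) (PhiF_entry i df sr) -mulrBr -mulrDr.
  have cB z : cmod z = r -> {for z, continuous (fun z => u z / Ps (v + s) z - u z / Ps s z)}.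
    by move=> zr; apply: continuousB; [exact: ck'|exact: ck].
  congr (_ * _); refine (esym (etrans (cID r0 cB cWW) _)).
  by rewrite (cIB r0 ck' ck).
rewrite cmodM -[leRHS]mulrA ler_wpM2l ?cmod_ge0 //.
have -> : 2 * (M * B ^+ 2 * r) * (2 * pi) * vnorm v ^+ 2 =
    2 * (M * (B * vnorm v) ^+ 2 * r) * (2 * pi - 0) by ring.
apply: cint_bound; [exact: ltW (pi2_gt0 R)|exact: circle_cts|] => t ht.
have zr := cmod_pol t r0.
rewrite !cmodM cmod_i mul1r zr ler_wpM2r // TE // cmodM cmodM cmodX.
have hP : 1 <= cmod (Ps s (pol r t)) by apply: cmod_Ps_ge1; rewrite zr.
have hP' : 1 <= cmod (Ps (v + s) (pol r t)) by apply: cmod_Ps_ge1; rewrite zr.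
have hL : cmod (Ls v (pol r t)) <= B * vnorm v.
  rewrite (le_trans (cmod_Ls _ _)) ?zr // /B mulrAC ler_wpM2r ?exprn_ge0 //.
  have -> : k%:R * vnorm v = \sum_(h < k) vnorm v.
    by rewrite sumr_const card_ord mulr_natl.
  by apply: ler_sum => h _; exact: cmod_coord_le.
rewrite cmodV ler_pdivrMr; last first.
  by rewrite cmodM cmodX mulr_gt0 ?exprn_gt0 // (lt_le_trans ltr01).
have h1 : cmod (u (pol r t)) * cmod (Ls v (pol r t)) ^+ 2 <= M * (B * vnorm v) ^+ 2.
  rewrite ler_pM ?cmod_ge0 ?exprn_ge0 ?uM //; first exact: cmod_ge0.
  by rewrite lerXn2r ?nnegrE ?cmod_ge0 // (le_trans (cmod_ge0 _) hL).
apply: (le_trans h1); apply: ler_peMr; first by rewrite mulr_ge0 // sqr_ge0.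
by rewrite cmodM cmodX mulr_ege1 // exprn_ege1.
Qed.

Lemma PhiF_derive f s (i : 'I_k) : (forall z, derivable f z 1) ->
  differentiable (fun t => PhiF f t i 0 : CC R) s /\
  forall v, 'D_v (fun t => PhiF f t i 0) s = \sum_(h < k) v 0 h * dPhi f s i h.
Proof.
move=> df; have [del del0 [K HK]] := PhiF_quadratic s i df.
exact: (@differentiable_quadratic R k (fun t => PhiF f t i 0) s (dPhi f s i) del K).
Qed.

Lemma holo_PhiF f : (forall z, derivable f z 1) -> holo (@PhiF R k f).
Proof.
by move=> df s; apply: differentiable_col => i; have [] := PhiF_derive s i df.
Qed.

Lemma pd_PhiF f (h : 'I_k) s : (forall z, derivable f z 1) ->
  pd h.+1 (PhiF f) s = \col_i dPhi f s i h.
Proof.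
move=> df; apply/colP => i; rewrite /pd derive_entry; last first.
  by apply: diff_derivable; exact: holo_PhiF.
have [_ ->] := PhiF_derive s i df; rewrite mxE (bigD1 h) //= mxE eqxx mul1r.
rewrite big1 ?addr0 // => j jh; rewrite mxE eqSS.
by rewrite (_ : (_ == _ :> nat) = false) ?mul0r //; apply/negbTE.
Qed.

End ContourRepresentation.

(** * The differential system *)

Section CompanionMatrix.
Variables (R : realType) (k : nat).
Hypothesis k0 : (0 < k)%N.
Implicit Types (s v t : 'rV[CC R]_k) (f : CC R -> CC R).
Local Notation c0 := ((0 +i* (2 * pi))^-1 : CC R).

Lemma scoef_rev s (j : 'I_k) : scoef s (k - j) = s 0 (rev_ord j).
Proof. by rewrite -scoefS; congr (scoef s _); rewrite /= subnSK. Qed.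

Lemma Amx_PhiF f s : (forall z, derivable f z 1) ->
  Amx s *m PhiF f s = PhiF (fun z => z * f z) s.
Proof.
move=> df; set r := Defs.rad s.
have r0 : 0 <= r := le_trans ler01 (rad_ge1 s).
have dzf (z : CC R) : derivable (fun z : CC R => z * f z) z 1.
  by apply: derivableM; [exact: derivable_id|exact: df].
have Pn z : cmod z = r -> Ps s z != 0 by move=> zr; apply: Ps_neq0; rewrite // zr.
have ck m z : cmod z = r -> {for z, continuous (fun w => f w * w ^+ m / Ps s w)}.
  by move=> zr; apply: derivable_cts; apply: derivable_kernel; rewrite ?zr.
apply/colP => i; refine (etrans _ (esym (PhiF_entry k0 i dzf (lexx r)))).
have -> : (Amx s *m PhiF f s) i 0 = \sum_j Amx s i j * PhiF f s j 0 by rewrite mxE.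
(* A row other than the last picks the next entry, which is multiplication of z^i by z under the
   integral. Only the last row involves s. *)
have [ik|ik] := eqVneq i.+1 k; last first.
  have ik' : (i.+1 < k)%N by rewrite ltn_neqAle ik ltn_ord.
  rewrite (bigD1 (Ordinal ik')) //= mxE (negbTE ik) eqxx mul1r big1 => [|j ji].
    rewrite addr0 (PhiF_entry k0 (Ordinal ik') df (lexx r)); congr (_ * _).
    by apply: eq_cI => // z _; rewrite exprS mulrCA mulrA.
  rewrite mxE (negbTE ik) (_ : (_ == _ :> nat) = false) ?mul0r //.
  by apply/negbTE; rewrite eq_sym.
have -> : \sum_j Amx s i j * PhiF f s j 0 =
    c0 * \sum_(h < k) ((-1) ^+ h * s 0 h) * cI r (fun z => f z * z ^+ (k - h.+1) / Ps s z).
  rewrite (reindex_inj rev_ord_inj) mulr_sumr; apply: eq_bigr => h _.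
  rewrite mxE ik eqxx scoef_rev rev_ordK (PhiF_entry k0 _ df (lexx r)) /=.
  by rewrite subnSK // subKn ?(ltnW (ltn_ord h)) // mulrCA.
congr (_ * _); rewrite -cI_sum //; last by move=> h z; exact: ck.
have cSum z : cmod z = r -> {for z, continuous
    (fun z => \sum_(h < k) (-1) ^+ h * s 0 h * (f z * z ^+ (k - h.+1) / Ps s z))}.
  move=> zr.
  have -> : (fun z => \sum_(h < k) (-1) ^+ h * s 0 h * (f z * z ^+ (k - h.+1) / Ps s z)) =
      fun z => - (f z * Ls s z / Ps s z).
    apply/funext => w; rewrite /Ls mulr_sumr mulr_suml -sumrN; apply: eq_bigr => h _.
    by rewrite exprS mulN1r; ring.
  apply: continuousN; apply: continuousM; last first.
    by apply: continuousV; [exact: Pn|apply: derivable_cts; exact: derivable_Ps].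
  apply: continuousM; first exact: derivable_cts.
  have -> : Ls s = fun w => Ps s w - w ^+ k.
    by apply/funext => w; rewrite PsE addrC addKr.
  apply: continuousB; apply: derivable_cts; first exact: derivable_Ps.
  exact: exprn_derivable.
(* The last row yields the integrand - f L_s / P_s. Adding f, whose integral vanishes, turns it into
   f z^k / P_s because P_s - L_s = z^k. *)
have e := cID r0 cSum (fun z _ => derivable_cts (df z)).
rewrite (cI_entire_eq0 r0 df) addr0 in e; refine (etrans (esym e) _).
apply: eq_cI => // z zr; have P0 := Pn z zr.
have -> : \sum_(h < k) (-1) ^+ h * s 0 h * (f z * z ^+ (k - h.+1) / Ps s z) =
    - (f z * (Ps s z - z ^+ k) / Ps s z).
  have -> : Ps s z - z ^+ k = Ls s z by rewrite PsE addrC addKr.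
  rewrite /Ls mulr_sumr mulr_suml -sumrN; apply: eq_bigr => h _.
  by rewrite exprS mulN1r; ring.
have -> : z ^+ k = z * z ^+ i by rewrite -exprS ik.
by move: (Ps s z) (f z) P0 => P F P0; field.
Qed.

Lemma AmxX_PhiF f s m : (forall z, derivable f z 1) ->
  Amx s ^+ m *m PhiF f s = PhiF (fun z => z ^+ m * f z) s.
Proof.
elim: m f => [|m IH] f df.
  rewrite expr0; have -> : (fun z => z ^+ 0 * f z) = f.
    by apply/funext => z; rewrite expr0 mul1r.
  exact: mul1mx.
have dzf (z : CC R) : derivable (fun z : CC R => z * f z) z 1.
  by apply: derivableM; [exact: derivable_id|exact: df].
rewrite exprSr -mulmxE -mulmxA (Amx_PhiF s df) (IH _ dzf).
have -> // : (fun z => z ^+ m.+1 * f z) = (fun z => z ^+ m * (z * f z)).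
by apply/funext => z; rewrite exprSr mulrA.
Qed.

(** Both sides have the kernel f z^i z^(k-h) / P_s^2: on the left z^(k-h) comes from differentiating
    P_s in s_h, on the right from A^(k-h), as P_s has derivative (-1)^k in s_k. The signs agree
    since (-1)^(k+h) (-1)^h = (-1)^k. *)
Lemma sysA_PhiF f : (forall z, derivable f z 1) -> sysA (@PhiF R k f).
Proof.
move=> df s h /andP[h1 hk1].
have hk : (h.-1 < k)%N by rewrite prednK // (leq_trans hk1) // leq_subr.
have kk : (k.-1 < k)%N by rewrite prednK.
have dg (z : CC R) : derivable (fun z : CC R => z ^+ (k - h) * f z) z 1.
  by apply: derivableM; [exact: exprn_derivable|exact: df].
have -> : (fun t => Amx t ^+ (k - h) *m PhiF f t) =
    @PhiF R k (fun z => z ^+ (k - h) * f z).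
  by apply/funext => t; exact: AmxX_PhiF.
have := @pd_PhiF R k k0 f (Ordinal hk) s df; rewrite /= prednK // => ->.
have := @pd_PhiF R k k0 _ (Ordinal kk) s dg; rewrite /= prednK // => ->.
apply/colP => i; rewrite !mxE /dPhi !prednK // mulrN; congr (- _).
rewrite mulrCA; congr (_ * _); rewrite mulrA -exprD.
have -> : (-1) ^+ (k + h + h) = (-1) ^+ k :> CC R.
  by rewrite -addnA exprD addnn -mul2n exprM sqrrN expr1n expr1n mulr1.
congr (_ * _); apply: eq_cI => [|z _]; first by rewrite addr_ge0 // (le_trans ler01) ?rad_ge1.
by rewrite subnn expr0 mulr1; congr (_ / _); ring.
Qed.

(** Linear part of the affine map s -> A(s), hence its differential at every point. *)
Definition dAmx v : 'M[CC R]_k :=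
  \matrix_(i, j) if (i.+1 == k)%N then (-1) ^+ (k - j.+1) * v 0 (rev_ord j) else 0.

Lemma AmxD v s : Amx (v + s) = dAmx v + Amx s.
Proof.
apply/matrixP => i j; rewrite !mxE !scoef_rev; case: ifP => _; last by rewrite add0r.
by rewrite mxE mulrDr.
Qed.

Lemma Amx_derive s i j : differentiable (fun t => Amx t i j : CC R) s /\
  forall v, 'D_v (fun t => Amx t i j) s = dAmx v i j.
Proof.
pose d (h : 'I_k) : CC R :=
  if (i.+1 == k)%N then (-1) ^+ (k - j.+1) * (h == rev_ord j)%:R else 0.
have dE v : \sum_h v 0 h * d h = dAmx v i j.
  rewrite /d mxE; case: ifP => _; last by rewrite big1 // => h _; rewrite mulr0.
  rewrite (bigD1 (rev_ord j)) //= eqxx mulr1 mulrC big1 ?addr0 // => h /negbTE ->.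
  by rewrite !mulr0.
(* The entries are affine in s, so the remainder is zero: K = 0, and the radius 1 is arbitrary. *)
have [|D E] := @differentiable_quadratic R k (fun t => Amx t i j) s d 1 0 ltr01.
  by move=> v _; rewrite AmxD mxE addrK dE subrr cmod0 mul0r.
by split=> // v; rewrite E dE.
Qed.

Lemma Amx_mul_derive (F : 'rV[CC R]_k -> 'cV[CC R]_k) s : differentiable F s ->
  differentiable (fun t => Amx t *m F t) s /\
  forall v, 'D_v (fun t => Amx t *m F t) s = dAmx v *m F s + Amx s *m 'D_v F s.
Proof.
move=> dF.
have eE i : (fun t => (Amx t *m F t) i 0) =
    \sum_(j < k) ((fun t => Amx t i j) * (fun t => F t j 0)).
  by apply/funext => t; rewrite mxE fct_sumE.
have dA i j := (Amx_derive s i j).1.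
have dFj j := @differentiable_entry R _ k F s j dF.
have dAF : differentiable (fun t => Amx t *m F t) s.
  apply: differentiable_col => i; rewrite eE; apply: differentiable_sum => j.
  exact: differentiableM.
split=> // v; apply/colP => i; rewrite derive_entry; last exact: diff_derivable.
rewrite eE derive_sum; last first.
  by move=> j; apply: derivableM; exact: diff_derivable.
rewrite [RHS]mxE [X in _ = X + _]mxE [X in _ = _ + X]mxE -big_split /=.
apply: eq_bigr => j _; have dFv : derivable F s v by exact: diff_derivable.
rewrite deriveM; try exact: diff_derivable.
rewrite (Amx_derive s i j).2 (derive_entry j dFv).
by rewrite addrC /GRing.scale /= (mulrC (F s j 0)).
Qed.

(** Each multiplication by A moves the basis row one place to the right, and as long as m < k the
    last row of A, the only one depending on s, has not entered. *)
Lemma AmxX_row0 s m (j : 'I_k) : (m < k)%N ->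
  (Amx s ^+ m) (Ordinal k0) j = (j == m :> nat)%:R.
Proof.
elim: m j => [|m IH] j mk; first by rewrite expr0 mxE eq_sym.
have mk' := ltnW mk.
rewrite exprSr mxE (bigD1 (Ordinal mk')) //= IH // eqxx mul1r.
rewrite big1 => [|l lm]; last first.
  rewrite IH // (_ : (_ == _ :> nat) = false) ?mul0r //; exact/negbTE.
rewrite addr0 mxE /= (ltn_eqF mk) eq_sym.
by case: eqP.
Qed.

(* Since the first row of A^m is the basis vector e_(m+1), the relation between the
   derivatives of A in s_h and s_k is the system satisfied by A itself. *)
Lemma dAmx_evec h s : (1 <= h <= k - 1)%N ->
  (-1) ^+ (k + h) *: dAmx (evec R k h) = dAmx (evec R k k) *m Amx s ^+ (k - h).
Proof.
move=> /andP[h1 hk]; have hk' : (h < k)%N by move: k0 hk; case: k => // n _; rewrite subn1.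
apply/matrixP => i j; rewrite !mxE; case: ifP => ik; last first.
  by rewrite mulr0 big1 // => l _; rewrite !mxE ik mul0r.
(* The only nonzero entry of the derivative of A in s_k is (-1)^(k-1) in the bottom left corner, so
   the product reads off row 0 of A^(k-h). *)
rewrite (bigD1 (Ordinal k0)) //= big1 => [|l l0]; last first.
  rewrite !mxE ik /= subnSK // (_ : (_ == _ :> nat) = false) ?mulr0 ?mul0r //.
  apply/negbTE; apply: contra l0 => /eqP e; apply/eqP/val_inj => /=.
  by have := ltn_ord l; lia.
rewrite !mxE ik /= (subnSK (ltn_ord j)) subn1 prednK // eqxx mulr1 addr0.
have mk : (k - h < k)%N by lia.
rewrite AmxX_row0 //.
have -> : (k - j == h)%N = (j == k - h :> nat)%N by have := ltn_ord j; lia.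
case: eqP => [jE|_]; last by rewrite !mulr0.
rewrite !mulr1 -exprD.
have -> : (k + h + (k - j.+1))%N = (2 * h + k.-1)%N by lia.
by rewrite exprD exprM sqrrN expr1n expr1n mul1r.
Qed.

Lemma holo_Amx_mul Phi : holo Phi -> holo (fun t => Amx t *m Phi t : 'cV[CC R]_k).
Proof. by move=> hP s; have [] := Amx_mul_derive (hP s). Qed.

Lemma holo_AmxX_mul Phi m : holo Phi -> holo (fun t => Amx t ^+ m *m Phi t : 'cV[CC R]_k).
Proof.
move=> hP; elim: m => [|m IH].
  have -> // : (fun t => Amx t ^+ 0 *m Phi t : 'cV[CC R]_k) = Phi.
  by apply/funext => t; rewrite expr0; exact: mul1mx.
have -> : (fun t => Amx t ^+ m.+1 *m Phi t : 'cV[CC R]_k) =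
    fun t => Amx t *m (Amx t ^+ m *m Phi t).
  by apply/funext => t; rewrite exprS -mulmxE mulmxA.
exact: holo_Amx_mul.
Qed.

(** A commutes with its powers, so A can be kept as the outer factor on both sides. The Leibniz rule
    then gives two terms that match separately, one by [dAmx_evec] and one by the system for
    [Phi]. *)
Lemma sysA_Amx_mul Phi : holo Phi -> sysA Phi ->
  sysA (fun t => Amx t *m Phi t : 'cV[CC R]_k).
Proof.
move=> hP sP s h hh.
have -> : (fun t => Amx t ^+ (k - h) *m (Amx t *m Phi t)) =
    fun t => Amx t *m (Amx t ^+ (k - h) *m Phi t).
  by apply/funext => t; rewrite !mulmxA !mulmxE -exprS -exprSr.
rewrite /pd (Amx_mul_derive (hP s)).2 (Amx_mul_derive (@holo_AmxX_mul Phi (k - h) hP s)).2.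
rewrite scalerDr scalemxAl (dAmx_evec s hh) scalemxAr -mulmxA; congr (_ + _ *m _).
exact: sP.
Qed.

Lemma sysA_AmxX_mul Phi m : holo Phi -> sysA Phi ->
  sysA (fun t => Amx t ^+ m *m Phi t : 'cV[CC R]_k).
Proof.
move=> hP sP; elim: m => [|m IH].
  have -> // : (fun t => Amx t ^+ 0 *m Phi t : 'cV[CC R]_k) = Phi.
  by apply/funext => t; rewrite expr0; exact: mul1mx.
have -> : (fun t => Amx t ^+ m.+1 *m Phi t : 'cV[CC R]_k) =
    fun t => Amx t *m (Amx t ^+ m *m Phi t).
  by apply/funext => t; rewrite exprS -mulmxE mulmxA.
by apply: sysA_Amx_mul => //; exact: holo_AmxX_mul.
Qed.

Lemma sysA_pd Phi h : sysA Phi -> (1 <= h <= k - 1)%N ->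
  pd h Phi = fun t => (-1) ^+ (k + h) *: pd k (fun t => Amx t ^+ (k - h) *m Phi t) t.
Proof. by move=> sP hh; apply/funext => t; rewrite -sP // signrZK. Qed.

Lemma sysA_second_derivative Phi h j s : holo Phi -> sysA Phi ->
  (1 <= h <= k - 1)%N -> (1 <= j <= k - 1)%N ->
  (-1) ^+ (h + j) *: pd j (pd h Phi) s
  = pd k (pd k (fun t => Amx t ^+ (2 * k - h - j) *m Phi t)) s.
Proof.
move=> hP sP hh jj.
pose G t := Amx t ^+ (k - h) *m Phi t : 'cV[CC R]_k.
have hG : holo G by exact: holo_AmxX_mul.
have sG : sysA G by exact: sysA_AmxX_mul.
pose H t := Amx t ^+ (2 * k - h - j) *m Phi t : 'cV[CC R]_k.
have HE : (fun t => Amx t ^+ (k - j) *m G t) = H.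
  apply/funext => t; rewrite /G /H mulmxA mulmxE -exprD; congr (_ ^+ _ *m _).
  by move: hh jj; lia.
have hH : holo H by exact: holo_AmxX_mul.
(* Besides the exchange of derivatives, [derive_sym] supplies the derivability needed to pull signs
   out of a second derivative; for [H], with equal directions, it is called for that alone. *)
have [d1 e1] := derive_sym (evec R k j) (evec R k k) s hG.
have [d2 _] := derive_sym (evec R k k) (evec R k k) s hH.
have E1 : pd j (pd h Phi) s = (-1) ^+ (k + h) *: pd j (pd k G) s.
  have z := @deriveZ _ _ _ (pd k G) ((-1) ^+ (k + h)) s (evec R k j) d1.
  exact (etrans (congr1 (fun F => pd j F s) (sysA_pd sP hh)) z).
have E2 : pd k (pd j G) s = (-1) ^+ (k + j) *: pd k (pd k H) s.
  have z := @deriveZ _ _ _ (pd k H) ((-1) ^+ (k + j)) s (evec R k k) d2.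
  have e := sysA_pd sG jj; rewrite HE in e.
  exact (etrans (congr1 (fun F => pd k F s) e) z).
have E3 : pd j (pd k G) s = pd k (pd j G) s by exact e1.
have S (X : 'cV[CC R]_k) :
    (-1) ^+ (h + j) *: ((-1) ^+ (k + h) *: ((-1) ^+ (k + j) *: X)) = X.
  rewrite !scalerA -!exprD (_ : (h + j + (k + h) + (k + j))%N = (2 * (h + j + k))%N).
    by rewrite exprM sqrrN expr1n expr1n scale1r.
  by lia.
have E := etrans E1 (congr1 (fun X => (-1) ^+ (k + h) *: X) (etrans E3 E2)).
exact (etrans (congr1 (fun X => (-1) ^+ (h + j) *: X) E) (S _)).
Qed.

End CompanionMatrix.

Unset Implicit Arguments. Set Strict Implicit. Set Printing Implicit Defensive.
Close Scope classical_set_scope.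
Close Scope complex_scope.

Theorem mainTheorem3 (R : realType) (k : nat) (hk : (2 <= k)%N) :
  (forall f : CC R -> CC R, (forall z : CC R, differentiable f z) ->
     holo (@PhiF R k f) /\ sysA (@PhiF R k f))
  /\
  (forall Phi : 'rV[CC R]_k -> 'cV[CC R]_k, holo Phi -> sysA Phi ->
     (forall (h j : nat) (s : 'rV[CC R]_k),
        (1 <= h <= k - 1)%N -> (1 <= j <= k - 1)%N ->
        (-1) ^+ (h + j) *: pd j (pd h Phi) s
        = pd k (pd k (fun t => Amx t ^+ (2 * k - h - j) *m Phi t)) s)
     /\ holo (fun t => Amx t *m Phi t) /\ sysA (fun t => Amx t *m Phi t)).
Proof.
have k0 : (0 < k)%N := ltnW hk.
split=> [f df|Phi hP sP].
  have df1 z : derivable f z 1 by apply/derivable1_diffP; exact: df.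
  by split; [exact: holo_PhiF|exact: sysA_PhiF].
split; first by move=> h j s hh jj; exact: sysA_second_derivative.
by split; [exact: holo_Amx_mul|exact: sysA_Amx_mul].
Qed.
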